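(* A PACS-structure of quaternionic type on a smooth manifold $M$ of dimension $4n\geq 8$ is given by an almost quaternionic structure on $M$ together with an almost conformally symplectic structure $\ell\subset\Lambda^2T^*M$, such that each non-zero element of $\ell$ is the real part of a quaternionically skew-Hermitian form.
   Context: An almost conformally symplectic structure on a smooth manifold $M$ of even dimension $\geq 4$ is a smooth line subbundle $\ell\subset\Lambda^2T^*M$ such that for each $x\in M$ each non-zero element of $\ell_x$ is non-degenerate as a bilinear form on $T_xM$. For a Lie group $G_0$ with an infinitesimally injective representation on a vector space $V$, a first order structure with structure group $G_0$ on a manifold $M$ with $\dim(M)=\dim(V)$ is a principal $G_0$-bundle $\mathcal P\to M$ endowed with a $G_0$-equivariant one-form $\theta\in\Omega^1(\mathcal P,V)$ whose kernel in each point is the vertical subbundle; for $G_0\subset GL(V)$ this is a reduction of the structure group of the linear frame bundle of $M$ to $G_0$. A quaternionically skew-Hermitian form on a right vector space $V$ over the quaternions $\mathbb H$ is a real bilinear map $\omega:V\times V\to\mathbb H$ such that $\omega(vq,w)=\overline{q}\,\omega(v,w)$, $\omega(v,wq)=\omega(v,w)q$ and $\omega(w,v)=-\overline{\omega(v,w)}$ for $v,w\in V$, $q\in\mathbb H$. Such a form can be recovered from its real part, which is a skew-symmetric real valued bilinear form preserved by multiplication by all unit quaternions; conversely, any such real bilinear form extends uniquely to a quaternionically skew-Hermitian form. On $\mathbb H^n$ there is, up to quaternionically linear automorphisms, a unique non-degenerate quaternionically skew-Hermitian form. Let $V=\mathbb H^n$ be endowed with a non-degenerate quaternionically skew-Hermitian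 form $\omega$ with real part $b$, let $SO^*(V)$ be the group of all quaternionically linear automorphisms $A$ of $V$ such that $\omega(Av,Aw)=\omega(v,w)$ for all $v,w$, and let $CSp(V)$ be the group of all real linear automorphisms $A$ of $V$ such that $b(Av,Aw)=\lambda b(v,w)$ for some $\lambda\in\mathbb R$ and all $v,w$. Put $G_0:=\mathbb H^*\cdot SO^*(V)\subset CSp(V)$, with the first factor $\mathbb H^*=\mathbb H\setminus\{0\}$ acting by quaternionic scalar multiplications; its Lie algebra is $\mathbb H\oplus\mathfrak{so}^*(V)$. (This representation arises as the degree $-1$ component of a contact grading of a Lie algebra of type $\mathfrak{so}^*$.) A PACS-structure (parabolic almost conformally symplectic structure) of quaternionic type is a first order structure with structure group $G_0$ coming from the representation $G_0\to CSp(V)$; the line spanned by $b$ in $\Lambda^2V^*$ induces its underlying almost conformally symplectic structure $\ell$. An almost quaternionic structure on a manifold of dimension $4n$ is a reduction of the structure group of the linear frame bundle to the subgroup $\mathbb H^*\cdot GL(n,\mathbb H)\subset GL(4n,\mathbb R)$ generated by quaternionic scalar multiplications and quaternionically linear automorphisms of $\mathbb H^n$. Equivalently, it is a bundle of subalgebras, with modeling algebra $\mathbb H$, in the bundle $L(TM,TM)$ of associative algebras, or a rank three subbundle of $L(TM,TM)$ which can locally be spanned by three almost complex structures $I,J,K$ satisfying the quaternion relations. The condition on elements of $\ell$ refers to the resulting quaternionic structure on each tangent space.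
   Formalization: As H^*·SO^*(V) scales b only positively, a PACS-structure also orients ℓ; the pair alone does not determine it, and none exists if ℓ is not orientable. Proved: each compatible pair comes locally from a PACS-structure, and globally from exactly one for each orientation of ℓ. *)

(* Defs.v *)
From HB Require Import structures.
From mathcomp Require Import all_boot all_order all_algebra.
From mathcomp Require Import ring.
From mathcomp Require Import boolp classical_sets functions reals topology.
From mathcomp Require Import normedtype derive.

Set Implicit Arguments.
Unset Strict Implicit.
Unset Printing Implicit Defensive.

Import Order.TTheory GRing.Theory Num.Theory numFieldNormedType.Exports.

Local Open Scope classical_set_scope.
Local Open Scope ring_scope.

(** * Quaternions *)

Record quat (R : Type) := Quat { qre : R; qi : R; qj : R; qk : R }.

Section QuatRing.
Variable R : comNzRingType.

Let tup (q : quat R) := (qre q, qi q, qj q, qk q).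
Let untup (t : R * R * R * R) := let: (a, b, c, d) := t in Quat a b c d.
Fact quat_tupK : cancel tup untup. Proof. by case. Qed.

HB.instance Definition _ := Choice.copy (quat R) (can_type quat_tupK).

Definition quat_add (p q : quat R) :=
  Quat (qre p + qre q) (qi p + qi q) (qj p + qj q) (qk p + qk q).
Definition quat_opp (p : quat R) := Quat (- qre p) (- qi p) (- qj p) (- qk p).
Definition quat_mul (p q : quat R) :=
  let: Quat a b c d := p in let: Quat a' b' c' d' := q in
  Quat (a * a' - b * b' - c * c' - d * d')
       (a * b' + b * a' + c * d' - d * c')
       (a * c' - b * d' + c * a' + d * b')
       (a * d' + b * c' - c * b' + d * a').
Definition quat_scale (a : R) (p : quat R) :=
  Quat (a * qre p) (a * qi p) (a * qj p) (a * qk p).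
Definition quat_conj (p : quat R) := Quat (qre p) (- qi p) (- qj p) (- qk p).

Local Ltac quat_ring :=
  repeat (let p := fresh in case=> [????] || move=> p);
  rewrite /quat_add /quat_opp /quat_mul /quat_scale /=; congr Quat; ring.

Fact quat_addA : associative quat_add. Proof. quat_ring. Qed.
Fact quat_addC : commutative quat_add. Proof. quat_ring. Qed.
Fact quat_add0 : left_id (Quat 0 0 0 0) quat_add. Proof. quat_ring. Qed.
Fact quat_addN : left_inverse (Quat 0 0 0 0) quat_opp quat_add.
Proof. quat_ring. Qed.

HB.instance Definition _ :=
  GRing.isZmodule.Build (quat R) quat_addA quat_addC quat_add0 quat_addN.

Fact quat_mulA : associative quat_mul. Proof. quat_ring. Qed.
Fact quat_mul1l : left_id (Quat 1 0 0 0) quat_mul. Proof. quat_ring. Qed.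
Fact quat_mul1r : right_id (Quat 1 0 0 0) quat_mul. Proof. quat_ring. Qed.
Fact quat_mulDl : left_distributive quat_mul quat_add. Proof. quat_ring. Qed.
Fact quat_mulDr : right_distributive quat_mul quat_add. Proof. quat_ring. Qed.
Fact quat_1neq0 : Quat 1 0 0 0 != 0 :> quat R.
Proof. by apply/eqP => -[] /eqP; rewrite oner_eq0. Qed.

HB.instance Definition _ := GRing.Zmodule_isNzRing.Build (quat R)
  quat_mulA quat_mul1l quat_mul1r quat_mulDl quat_mulDr quat_1neq0.

Fact quat_scaleA a b v : quat_scale a (quat_scale b v) = quat_scale (a * b) v.
Proof. by move: v; quat_ring. Qed.
Fact quat_scale1 : left_id 1 quat_scale. Proof. quat_ring. Qed.
Fact quat_scaleDr : right_distributive quat_scale quat_add.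
Proof. quat_ring. Qed.
Fact quat_scaleDl v : {morph quat_scale^~ v : a b / a + b >-> quat_add a b}.
Proof. by move: v; quat_ring. Qed.

HB.instance Definition _ := GRing.Zmodule_isLmodule.Build R (quat R)
  quat_scaleA quat_scale1 quat_scaleDr quat_scaleDl.

End QuatRing.

(** * Quaternionic linear algebra *)

Section QuatLinear.
Variable R : realType.

(* [rs] is the right scalar multiplication of the quaternionic vector space
   underlying the real vector space [W]. *)
Definition quat_skew_hermitian (W : lmodType R) (rs : W -> quat R -> W)
    (omega : W -> W -> quat R) : Prop :=
  [/\ bilinear_for *:%R *:%R omega,
      forall v w q, omega (rs v q) w = quat_conj q * omega v w,
      forall v w q, omega v (rs w q) = omega v w * q
    & forall v w, omega w v = - quat_conj (omega v w)].

Definition real_part (W : Type) (omega : W -> W -> quat R) : W -> W -> R :=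
  fun v w => qre (omega v w).

Definition nondegenerate_form (W A : zmodType) (beta : W -> W -> A) : Prop :=
  forall v, (forall w, beta v w = 0) -> v = 0.

Definition skew_bilinear (W : lmodType R) (beta : W -> W -> R) : Prop :=
  bilinear_for *%R *%R beta /\ forall v w, beta w v = - beta v w.

Definition Hn (n : nat) : lmodType R := {ffun 'I_n -> quat R}.

Definition rscale (n : nat) (v : Hn n) (q : quat R) : Hn n :=
  [ffun i => (v : {ffun 'I_n -> quat R}) i * q].

Definition GLH (n : nat) : set (Hn n -> Hn n) :=
  [set A | [/\ linear A, bijective A &
               forall v q, A (rscale v q) = rscale (A v) q]].

Definition SOstar (n : nat) (omega : Hn n -> Hn n -> quat R) :
    set (Hn n -> Hn n) :=
  [set A | GLH A /\ forall v w, omega (A v) (A w) = omega v w].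

(* The subgroup [H^* . G] of [GL(4n, R)], for a subgroup [G] of [GL(n, H)]. *)
Definition Hstar_mul (n : nat) (G : set (Hn n -> Hn n)) :
    set (Hn n -> Hn n) :=
  [set A | exists q : quat R, q <> 0 /\
    exists2 B, G B & A = (fun v => rscale (B v) q)].

End QuatLinear.

(** * Smooth manifolds *)

Section Smooth.
Variables (R : realType) (V W : normedModType R).

(* [k] times differentiable on [U]; meant for open [U] and finite-dimensional
   [V]. *)
Fixpoint differentiable_upto (k : nat) (U : set V) (f : V -> W) : Prop :=
  if k is k'.+1 then
    (forall x, U x -> differentiable f x) /\
    (forall v, differentiable_upto k' U (fun x => 'D_v f x))
  else True.

Definition smooth_on (U : set V) (f : V -> W) : Prop :=
  forall k, differentiable_upto k U f.

End Smooth.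

Record smoothManifold (R : realType) (m : nat) := SmoothManifold {
  carrier :> topologicalType;
  manifold_hausdorff : hausdorff_space carrier;
  manifold_second_countable : @second_countable carrier;
  chart : Type;
  chart_dom : chart -> set carrier;
  chart_coord : chart -> carrier -> 'rV[R]_m;
  chart_param : chart -> 'rV[R]_m -> carrier;
  chart_dom_open : forall i, open (chart_dom i);
  chart_dom_cover : forall x, exists i, chart_dom i x;
  chart_image_open : forall i, open (chart_coord i @` chart_dom i);
  chart_coordK : forall i x,
    chart_dom i x -> chart_param i (chart_coord i x) = x;
  chart_coord_continuous : forall i x,
    chart_dom i x -> {for x, continuous (chart_coord i)};
  chart_param_continuous : forall i z,
    (chart_coord i @` chart_dom i) z -> {for z, continuous (chart_param i)};
  transition_smooth : forall i j,
    smooth_on (chart_coord i @` (chart_dom i `&` chart_dom j))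
      (chart_coord j \o chart_param i)
}.

Section Tangent.
Variables (R : realType) (m : nat) (M : smoothManifold R m).

(* A tangent vector at [x] is the family of its coordinate vectors in all the
   charts around [x], related by the differentials of the transition maps; the
   entries at the charts not defined at [x] carry no information and are set
   to 0. *)
Definition is_tangent (x : M) (v : chart M -> 'rV[R]_m) : Prop :=
  (forall i j, chart_dom i x -> chart_dom j x ->
     v j = 'd (chart_coord j \o chart_param i) (chart_coord i x) (v i)) /\
  (forall i, ~ chart_dom i x -> v i = 0).

Definition tangent_pred (x : M) : pred (chart M -> 'rV[R]_m) :=
  fun v => `[< is_tangent x v >].

Fact tangent_submod_closed (x : M) : submod_closed (tangent_pred x).
Proof.
split=> [|a u v /asboolP[u1 u2] /asboolP[v1 v2]]; apply/asboolP; split.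
- by move=> i j _ _; rewrite linear0.
- by [].
- move=> i j xi xj; rewrite !fctE linearP.
  by rewrite -u1 // -v1.
- by move=> i xi; rewrite !fctE u2 // v2 // scaler0 addr0.
Qed.

HB.instance Definition _ (x : M) :=
  GRing.isSubmodClosed.Build R (chart M -> 'rV[R]_m) (tangent_pred x)
    (tangent_submod_closed x).

Record tangent (x : M) := Tangent {
  tcoord :> chart M -> 'rV[R]_m;
  tcoordP : tcoord \in tangent_pred x }.

HB.instance Definition _ (x : M) := [isSub for @tcoord x].
HB.instance Definition _ (x : M) := [Choice of tangent x by <:].
HB.instance Definition _ (x : M) :=
  [SubChoice_isSubZmodule of tangent x by <:].
HB.instance Definition _ (x : M) :=
  [SubZmodule_isSubLmodule of tangent x by <:].

Definition smooth_function (U : set M) (f : M -> R) : Prop :=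
  forall i, smooth_on (chart_coord i @` (chart_dom i `&` U))
    (f \o chart_param i : _ -> R^o).

Definition smooth_vector_field (U : set M) (X : forall x : M, tangent x) :
    Prop :=
  forall i, smooth_on (chart_coord i @` (chart_dom i `&` U))
    (fun z => X (chart_param i z) i).

(* A family of bilinear forms is smooth when its values on smooth vector
   fields are smooth functions. *)
Definition smooth_form (U : set M)
    (sigma : forall x : M, tangent x -> tangent x -> R) : Prop :=
  forall (U' : set M) (X Y : forall x : M, tangent x),
    open U' -> U' `<=` U ->
    smooth_vector_field U' X -> smooth_vector_field U' Y ->
    smooth_function U' (fun x => sigma x (X x) (Y x)).

(** * First order structures *)

Definition is_frame (V : lmodType R) (x : M) (u : V -> tangent x) : Prop :=
  linear u /\ bijective u.

(* For a subgroup [G] of [GL(V)], with [dim V = m]: a reduction to [G], over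
   the open subset [U] of [M], of the linear frame bundle of [M], the frames
   at [x] being the linear isomorphisms from [V] onto the tangent space at
   [x].  The action of [G] on frames is always free, since frames are
   injective. *)
Definition reduction (V : lmodType R) (G : set (V -> V)) (U : set M)
    (P : forall x : M, set (V -> tangent x)) : Prop :=
  [/\ forall x, U x -> P x `<=` @is_frame V x,
      forall x u, U x -> P x u -> P x = [set u \o A | A in G]
    & forall x, U x -> exists (U' : set M) (s : forall y : M, V -> tangent y),
        [/\ open_nbhs x U', U' `<=` U,
            forall v, smooth_vector_field U' (fun y => s y v)
          & forall y, U' y -> P y (s y)]].

Definition extension (V : lmodType R) (G : set (V -> V))
    (P : forall x : M, set (V -> tangent x)) (x : M) : set (V -> tangent x) :=
  [set u \o A | u in P x & A in G].

(* The forms on the tangent spaces corresponding, via some frame in [P], to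
   arbitrary (resp. positive) multiples of [b]. *)
Definition induced_line (V : lmodType R) (b : V -> V -> R)
    (P : forall x : M, set (V -> tangent x)) (x : M) :
    set (tangent x -> tangent x -> R) :=
  [set beta | exists2 u, P x u &
     exists c : R, forall v w, beta (u v) (u w) = c * b v w].

Definition induced_ray (V : lmodType R) (b : V -> V -> R)
    (P : forall x : M, set (V -> tangent x)) (x : M) :
    set (tangent x -> tangent x -> R) :=
  [set beta | exists2 u, P x u &
     exists2 c : R, 0 < c & forall v w, beta (u v) (u w) = c * b v w].

(** * Almost conformally symplectic structures *)

Definition line_subbundle
    (l : forall x : M, set (tangent x -> tangent x -> R)) : Prop :=
  forall x, exists (U : set M)
      (sigma : forall y : M, tangent y -> tangent y -> R),
    [/\ open_nbhs x U, smooth_form U sigma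
      & forall y, U y -> [/\ skew_bilinear (sigma y), sigma y <> 0
          & l y = [set beta | exists c : R,
                     beta = (fun v w => c * sigma y v w)]]].

Definition almost_conformally_symplectic
    (l : forall x : M, set (tangent x -> tangent x -> R)) : Prop :=
  line_subbundle l /\
  forall x beta, l x beta -> beta <> 0 -> nondegenerate_form beta.

(* An orientation of a line subbundle [l], as the choice of one of the two
   open rays of each line [l x] in a way which is locally spanned by smooth
   sections. *)
Definition line_orientation
    (l o : forall x : M, set (tangent x -> tangent x -> R)) : Prop :=
  forall x, exists (U : set M)
      (sigma : forall y : M, tangent y -> tangent y -> R),
    [/\ open_nbhs x U, smooth_form U sigma
      & forall y, U y -> [/\ l y (sigma y), sigma y <> 0
          & o y = [set beta | exists2 c : R, 0 < c &
                     beta = (fun v w => c * sigma y v w)]]].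

(** * Quaternionic structures *)

Section Quaternionic.
Variable n : nat.
Local Notation V := (Hn R n).

Definition almost_quaternionic (Q : forall x : M, set (V -> tangent x)) :
    Prop :=
  reduction (Hstar_mul (@GLH R n)) setT Q.

(* The right quaternionic scalar multiplication on the tangent space at [x]
   transported by a frame [u]. *)
Definition frame_rscale (x : M) (u : V -> tangent x) (t : tangent x)
    (q : quat R) : tangent x :=
  u (rscale (xget 0 [set v | u v = t]) q).

Definition real_part_compatible (Q : forall x : M, set (V -> tangent x))
    (l : forall x : M, set (tangent x -> tangent x -> R)) : Prop :=
  forall x beta, l x beta -> beta <> 0 -> forall u, Q x u ->
    exists2 omega, quat_skew_hermitian (frame_rscale u) omega
                 & beta = real_part omega.

Definition PACS_on (omega : V -> V -> quat R) (U : set M)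
    (P : forall x : M, set (V -> tangent x)) : Prop :=
  reduction (Hstar_mul (SOstar omega)) U P.

Definition underlying_quaternionic (P : forall x : M, set (V -> tangent x)) :=
  extension (Hstar_mul (@GLH R n)) P.

Definition underlying_acs (omega : V -> V -> quat R)
    (P : forall x : M, set (V -> tangent x)) :=
  induced_line (real_part omega) P.

(* An element [v |-> B v * q] of [H^* . SO^*(V)] multiplies the real part [b]
   of [omega] by [|q|^2 > 0], so a reduction to this group singles out the ray
   of positive multiples of [b] in each line.  It is not determined by the line
   and the quaternionic structure: some [B] in [GL(n, H)] satisfies
   [omega (B v) (B w) = - omega v w]. *)
Definition underlying_orientation (omega : V -> V -> quat R)
    (P : forall x : M, set (V -> tangent x)) :=
  induced_ray (real_part omega) P.

End Quaternionic.
End Tangent.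

Arguments extension {R m M V} G P x _.
Arguments induced_line {R m M V} b P x _.
Arguments induced_ray {R m M V} b P x _.
Arguments underlying_quaternionic {R m M n} P x _.
Arguments underlying_acs {R m M n} omega P x _.
Arguments underlying_orientation {R m M n} omega P x _.

(* Main.v *)
(* From a PACS-structure, the quaternionic structure and the line are
   obtained pointwise; in an adapted local frame s the line is spanned by
   b(s^-1 X, s^-1 Y), which is smooth because the coordinates of s^-1 X are
   given by the inverse of the matrix of s in a chart.

   Conversely, a local section of l, read in a local frame of the
   quaternionic structure, is the real part of a smooth family of
   non-degenerate skew-Hermitian forms on H^n. The orthogonal complement of
   fewer than n orthonormal vectors contains a non-isotropic vector, and the
   value p = omega(v, v), an imaginary quaternion, is carried to i by a
   smooth rescaling v q as long as p is not a negative multiple of i; this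
   can be arranged at one point, hence nearby. So Gram-Schmidt gives smooth
   families of vectors with omega_y(f_a, f_b) = delta_ab i, and comparing
   with such a basis for the model form gives frames adapted to the chosen
   section. The sign of the section is free, since all non-degenerate forms
   are equivalent; an orientation of l fixes it, and two adapted frames with
   the same sign differ by an element of H^* SO^*. *)

Require Import Defs.
From HB Require Import structures.
From mathcomp Require Import all_boot all_order all_algebra.
From mathcomp Require Import ring lra.
From mathcomp Require Import boolp classical_sets functions reals topology.
From mathcomp Require Import interval_inference normedtype landau derive
  realfun.

Set Implicit Arguments.
Unset Strict Implicit.
Unset Printing Implicit Defensive.

Import Order.TTheory GRing.Theory Num.Theory numFieldNormedType.Exports.

Local Open Scope classical_set_scope.
Local Open Scope ring_scope.

(** * Smooth maps between normed spaces *)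

Section SmoothCalculus.
Variable R : realType.

(** Write [g = f + (g - f)]. The difference vanishes near [x], so its expansion there has zero
    linear part and zero remainder. *)
Lemma near_eq_differentiable (V W : normedModType R) (f g : V -> W) (x : V) :
  (\near x, f x = g x) -> differentiable f x -> differentiable g x.
Proof.
move=> fg df; have gE : g = f + (g - f) by rewrite addrC subrK.
rewrite gE; apply: differentiableD => //.
set h := g - f.
have h0 : \near x, h x = 0.
  by near=> y; rewrite /h !fctE (near fg y) ?subrr.
have hx0 : h x = 0 by exact: nbhs_singleton h0.
have ho : h \o shift x = cst (h x) + 'd (cst 0) x +o_ 0 id.
  apply/eqaddoP => _ /posnumP[e]; near=> z.
  rewrite diff_cst hx0 addr0.
  have -> : (h \o shift x - cst 0) z = h (z + x) by exact: subr0.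
  suff -> : h (z + x) = 0 by rewrite normr0 mulr_ge0.
  by near: z; move: h0; rewrite (near_shift 0) /= subr0.
apply/diff_locallyP; have dE : 'd h x = 'd (cst 0) x :> (V -> W).
  by apply: diff_unique => //; apply: diff_continuous; exact:
    differentiable_cst.
rewrite dE; split => //; apply: diff_continuous; exact: differentiable_cst.
Unshelve. all: by end_near. Qed.

(** Scaling [R^o * W -> W] is a continuous bilinear map, so the product rule is its differential
    composed with that of the pair [(f, g)]. *)
Lemma differentiable_scale (V W : normedModType R) (f : V -> R^o) (g : V -> W)
    (x : V) : differentiable f x -> differentiable g x ->
  differentiable (fun y => f y *: g y) x /\
  forall v, 'D_v (fun y => f y *: g y) x = f x *: 'D_v g x + 'D_v f x *: g x.
Proof.
move=> df dg.
have bs : bilinear_for (GRing.Scale.Law.clone _ _ *:%R _)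
    (GRing.Scale.Law.clone _ _ *:%R _) (fun (a : R^o) (w : W) => a *: w).
  split=> [u'|u] a y z /=; first by rewrite scalerDl scalerA.
  by rewrite scalerDr !scalerA [_ * a]mulrC.
pose bM := bilinear_isBilinear.Build R R^o W W _ _
  (fun (a : R^o) (w : W) => a *: w) bs.
pose bL : {bilinear R^o -> W -> W} :=
  HB.pack (fun (a : R^o) (w : W) => a *: w) bM.
have bc : continuous (fun p : R^o * W => bL p.1 p.2) by exact: scale_continuous.
have dp := differentiable_pair df dg.
have db := differentiable_bilin (f x, g x) bc.
have dc := differentiable_comp dp db.
split=> // v; rewrite !deriveE //.
by rewrite (diff_comp dp db) diff_pair // diff_bilin.
Qed.


Lemma differentiable_uptoS (V W : normedModType R) k (U : set V) (f : V -> W) :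
  differentiable_upto k.+1 U f -> differentiable_upto k U f.
Proof.
elim: k f => //= k IH f [df Df]; split=> // v; exact: IH (Df v).
Qed.

Section Upto.
Variables (V W : normedModType R).
Implicit Types (U : set V) (f g : V -> W) (k : nat).

(** As [U] is open, equality on [U] holds near each of its points, so the directional derivatives
    also agree on [U] and the induction can go on. *)
Lemma eq_differentiable_upto k U f g : open U -> (forall x, U x -> f x = g x) ->
  differentiable_upto k U f -> differentiable_upto k U g.
Proof.
move=> oU; elim: k f g => //= k IH f g fg [df Df].
have nfg x : U x -> \near x, f x = g x.
  move=> Ux; have : nbhs x U by exact: open_nbhs_nbhs.
  by apply: filterS => y; exact: fg.
split=> [x Ux|v]; first exact: near_eq_differentiable (nfg x Ux) (df x Ux).
by apply: IH (Df v) => x Ux; apply: near_eq_derive; exact: nfg.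
Qed.

Lemma sub_differentiable_upto k U U' f : U' `<=` U ->
  differentiable_upto k U f -> differentiable_upto k U' f.
Proof.
move=> UU; elim: k f => //= k IH f [df Df].
by split=> [x /UU /df //|v]; exact: IH (Df v).
Qed.

Lemma differentiable_upto_cst k U (a : W) : differentiable_upto k U (cst a).
Proof.
elim: k a => //= k IH a; split=> [x _|v]; first exact: differentiable_cst.
have -> : (fun x => 'D_v (cst a) x) = cst (0 : W) :> (V -> W).
  by apply/funext => x; exact: derive_cst.
exact: IH.
Qed.

Lemma differentiable_uptoD k U f g : open U ->
  differentiable_upto k U f -> differentiable_upto k U g ->
  differentiable_upto k U (f + g).
Proof.
move=> oU; elim: k f g => //= k IH f g [df Df] [dg Dg].
split=> [x Ux|v]; first by apply: differentiableD; [exact: df|exact: dg].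
apply: eq_differentiable_upto (IH _ _ (Df v) (Dg v)) => // x Ux.
by rewrite deriveD //; apply: diff_derivable; [exact: df|exact: dg].
Qed.

Lemma differentiable_upto_scale k U (f : V -> R^o) g : open U ->
  differentiable_upto k U f -> differentiable_upto k U g ->
  differentiable_upto k U (fun x => f x *: g x).
Proof.
move=> oU; elim: k f g => //= k IH f g [df Df] [dg Dg].
split=> [x Ux|v]; first by have [] := differentiable_scale (df x Ux) (dg x Ux).
have H1 : differentiable_upto k U f.
  by apply: differentiable_uptoS; split.
have H2 : differentiable_upto k U g by apply: differentiable_uptoS; split.
have H := differentiable_uptoD oU (IH _ _ H1 (Dg v)) (IH _ _ (Df v) H2).
apply: (eq_differentiable_upto oU _ H) => x Ux.
have [_ Dfg] := differentiable_scale (df x Ux) (dg x Ux).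
by rewrite Dfg.
Qed.

End Upto.

Lemma differentiable_upto_linear (V W W' : normedModType R) (L : {linear W ->
  W'})
    k (U : set V) (f : V -> W) : open U -> continuous L ->
  differentiable_upto k U f -> differentiable_upto k U (L \o f).
Proof.
move=> oU cL; elim: k f => //= k IH f [df Df].
have dL y : differentiable L y by exact: linear_differentiable.
split=> [x Ux|v]; first by apply: differentiable_comp => //; exact: df.
apply: eq_differentiable_upto (IH _ (Df v)) => // x Ux /=.
have dfx := df x Ux; have dLx := dL (f x).
have dcx := differentiable_comp dfx dLx.
by rewrite (deriveE _ dfx) (deriveE _ dcx) (diff_comp dfx dLx) /= diff_lin.
Qed.

Section UptoScalar.
Variables (V : normedModType R).
Implicit Types (U : set V) (f : V -> R^o) (k : nat).

(** The derivative of [1/f] is [- (1/f)^2 f'], in which [1/f] is covered by the induction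
    hypothesis. *)
Lemma differentiable_uptoV k U f : open U -> (forall x, U x -> f x != 0) ->
  differentiable_upto k U f ->
  differentiable_upto k U ((fun x => (f x)^-1) : V -> R^o).
Proof.
move=> oU f0; elim: k => //= k IH [df Df].
split=> [x Ux|v]; first by apply: differentiableV; [exact: df|exact: f0].
have If : differentiable_upto k U ((fun x => (f x)^-1) : V -> R^o).
  by apply: IH; apply: differentiable_uptoS; split.
have I2 := differentiable_upto_scale oU If If.
have I3 := differentiable_upto_scale oU (differentiable_upto_cst k U (- 1 :
  R^o)) I2.
apply: eq_differentiable_upto (differentiable_upto_scale oU I3 (Df v)) => // x
  Ux.
rewrite deriveV ?f0 //; last by apply: diff_derivable; exact: df.
by congr (_ *: _); rewrite /cst /GRing.scale /= mulN1r -invfM expr2.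
Qed.

(** The derivative is [f' / (2 sqrt f)]: the square root is covered by the induction hypothesis and
    its inverse by [differentiable_uptoV]. *)
Lemma differentiable_upto_sqrt k U f : open U -> (forall x, U x -> 0 < f x) ->
  differentiable_upto k U f ->
  differentiable_upto k U ((fun x => Num.sqrt (f x)) : V -> R^o).
Proof.
move=> oU f0; elim: k => //= k IH [df Df].
have ds x : U x -> differentiable (Num.sqrt : R -> R) (f x).
  move=> Ux; apply/derivable1_diffP.
  by have [] := is_derive1_sqrt (f0 x Ux).
split=> [x Ux|v].
  by apply: (@differentiable_comp _ _ _ _ f Num.sqrt); [exact: df|exact: ds].
have If : differentiable_upto k U ((fun x => Num.sqrt (f x)) : V -> R^o).
  by apply: IH; apply: differentiable_uptoS; split.
have I2 := differentiable_upto_scale oU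
  (differentiable_upto_cst k U (2 : R^o)) If.
have I3 := differentiable_uptoV oU _ I2.
apply: eq_differentiable_upto
  (differentiable_upto_scale oU (I3 _) (Df v)) => // x Ux; last first.
  by rewrite /cst /GRing.scale /= mulf_neq0 // gt_eqF // sqrtr_gt0 f0.
have dfx := df x Ux; have dsx := ds x Ux.
have dcx := @differentiable_comp _ _ _ _ f Num.sqrt x dfx dsx.
rewrite (deriveE _ dfx) (deriveE _ dcx) (diff_comp dfx dsx) /=.
set y : R := 'd f x v.
(* A linear map on [R] is determined by its value at 1, which is the one-variable derivative of the
   square root. *)
have -> : 'd (Num.sqrt : R -> R) (f x) y = y *: 'd (Num.sqrt : R -> R) (f x) 1.
  by rewrite -linearZ /= /GRing.scale /= mulr1.
rewrite -(deriveE _ dsx).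
have [_ ->] := is_derive1_sqrt (f0 x Ux).
by rewrite /GRing.scale /= mulrC.
Qed.

End UptoScalar.

Section SmoothOnScalar.
Variables (V : normedModType R) (U : set V).
Hypothesis oU : open U.
Implicit Types f g : V -> R^o.

Lemma smooth_on_cst (c : R) : smooth_on U (cst c : V -> R^o).
Proof. by move=> k; exact: differentiable_upto_cst. Qed.

Lemma smooth_onD f g : smooth_on U f -> smooth_on U g ->
  smooth_on U ((fun x => f x + g x) : V -> R^o).
Proof. by move=> sf sg k; exact: differentiable_uptoD (sf k) (sg k). Qed.

Lemma smooth_onM f g : smooth_on U f -> smooth_on U g ->
  smooth_on U ((fun x => f x * g x) : V -> R^o).
Proof. by move=> sf sg k; exact: differentiable_upto_scale (sf k) (sg k). Qed.

Lemma smooth_onV f : (forall x, U x -> f x != 0) -> smooth_on U f ->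
  smooth_on U ((fun x => (f x)^-1) : V -> R^o).
Proof. by move=> f0 sf k; exact: differentiable_uptoV (sf k). Qed.

Lemma smooth_on_sum (I : Type) (r : seq I) (f : I -> V -> R^o) :
  (forall j, smooth_on U (f j)) ->
  smooth_on U ((fun x => \sum_(j <- r) f j x) : V -> R^o).
Proof.
move=> sf; elim: r => [|j r IH].
  by under eq_fun do rewrite big_nil; exact: smooth_on_cst.
by under eq_fun do rewrite big_cons; exact: smooth_onD.
Qed.

Lemma smooth_on_prod (I : Type) (r : seq I) (f : I -> V -> R^o) :
  (forall j, smooth_on U (f j)) ->
  smooth_on U ((fun x => \prod_(j <- r) (f j x : R)) : V -> R^o).
Proof.
move=> sf; elim: r => [|j r IH].
  by under eq_fun do rewrite big_nil; exact: smooth_on_cst.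
by under eq_fun do rewrite big_cons; exact: smooth_onM.
Qed.

Lemma smooth_on_det k (A : V -> 'M[R]_k) :
  (forall i j, smooth_on U ((fun x => A x i j) : V -> R^o)) ->
  smooth_on U ((fun x => \det (A x)) : V -> R^o).
Proof.
move=> sA; apply: smooth_on_sum => s; apply: smooth_onM.
  exact: smooth_on_cst.
by apply: smooth_on_prod => i; exact: sA.
Qed.

Lemma smooth_on_invmx k (A : V -> 'M[R]_k) :
  (forall x, U x -> A x \in unitmx) ->
  (forall i j, smooth_on U ((fun x => A x i j) : V -> R^o)) ->
  forall i j, smooth_on U ((fun x => invmx (A x) i j) : V -> R^o).
Proof.
move=> uA sA i j.
(* This is the cofactor formula. [invmx] returns its argument on singular matrices, so the two sides
   are compared on [U] only. *)
have s : smooth_on U ((fun x => (\det (A x))^-1 *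
    ((-1) ^+ (j + i) * \det (row' j (col' i (A x))))) : V -> R^o).
  apply: smooth_onM.
    apply: smooth_onV; last exact: smooth_on_det.
    by move=> x /uA; rewrite unitmxE unitfE.
  apply: smooth_onM; first exact: smooth_on_cst.
  by apply: smooth_on_det => a b; under eq_fun do rewrite !mxE; exact: sA.
move=> h; apply: eq_differentiable_upto (s h) => // x Ux.
by rewrite /invmx (uA x Ux) !mxE.
Qed.

End SmoothOnScalar.

End SmoothCalculus.

(** * Smooth functions and vector fields on a manifold *)

Section ManifoldCalculus.
Variables (R : realType) (m : nat) (M : smoothManifold R m).
Implicit Types (U : set M) (f g : M -> R) (X Y : forall x : M, tangent x).

Definition chart_image U (i : chart M) : set 'rV[R]_m :=
  chart_coord i @` (chart_dom i `&` U).

(** Inside the open image of the chart, the image of [U] is the preimage of [U] under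
    [chart_param i], which is continuous there. *)
Lemma open_chart_image U i : open U -> open (chart_image U i).
Proof.
move=> oU; have -> : chart_image U i =
    chart_coord i @` chart_dom i `&` chart_param i @^-1` U.
  apply/seteqP; split=> [_ [x [xi Ux] <-]|z [[x xi <-]]].
    by split; [exists x|rewrite /= chart_coordK].
  by rewrite /preimage /= chart_coordK // => Ux; exists x.
rewrite openE => z [zi zU]; rewrite /interior.
apply: filterI.
  by apply: open_nbhs_nbhs; split; [exact: chart_image_open|].
by apply: (chart_param_continuous zi); exact: open_nbhs_nbhs.
Qed.

Lemma chart_imageP U i z : chart_image U i z ->
  [/\ chart_dom i (chart_param i z), U (chart_param i z)
    & chart_coord i (chart_param i z) = z].
Proof. by case=> x [xi Ux] <-; rewrite chart_coordK. Qed.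

Lemma sub_chart_image U U' i :
  U' `<=` U -> chart_image U' i `<=` chart_image U i.
Proof. by move=> UU _ [x [xi /UU Ux] <-]; exists x. Qed.

Lemma sub_smooth_function U U' f :
  U' `<=` U -> smooth_function U f -> smooth_function U' f.
Proof.
move=> UU sf i k; apply: sub_differentiable_upto (sf i k).
exact: sub_chart_image.
Qed.

Lemma sub_smooth_vector_field U U' X :
  U' `<=` U -> smooth_vector_field U X -> smooth_vector_field U' X.
Proof.
move=> UU sf i k; apply: sub_differentiable_upto (sf i k).
exact: sub_chart_image.
Qed.

Lemma eq_smooth_function U f g : open U -> (forall x, U x -> f x = g x) ->
  smooth_function U f -> smooth_function U g.
Proof.
move=> oU fg sf i k; apply: eq_differentiable_upto (sf i k).
  exact: open_chart_image.
by move=> z /chart_imageP[_ Uz _]; exact: fg.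
Qed.

Lemma smooth_function_cst U (c : R) : smooth_function U (fun=> c).
Proof. by move=> i k; exact: differentiable_upto_cst. Qed.

Lemma smooth_functionD U f g : open U ->
  smooth_function U f -> smooth_function U g ->
  smooth_function U (fun x => f x + g x).
Proof.
move=> oU sf sg i k.
exact: (@differentiable_uptoD _ _ R^o k _ (f \o chart_param i)
  (g \o chart_param i) (open_chart_image oU) (sf i k) (sg i k)).
Qed.

Lemma smooth_functionM U f g : open U ->
  smooth_function U f -> smooth_function U g ->
  smooth_function U (fun x => f x * g x).
Proof.
move=> oU sf sg i k.
exact: (@differentiable_upto_scale _ _ R^o k _ (f \o chart_param i)
  (g \o chart_param i) (open_chart_image oU) (sf i k) (sg i k)).
Qed.

Lemma smooth_functionN U f : open U ->
  smooth_function U f -> smooth_function U (fun x => - f x).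
Proof.
move=> oU sf.
apply: eq_smooth_function (smooth_functionM oU (smooth_function_cst U (-1)) sf)
  => // x _.
by rewrite mulN1r.
Qed.

Lemma smooth_functionV U f : open U -> (forall x, U x -> f x != 0) ->
  smooth_function U f -> smooth_function U (fun x => (f x)^-1).
Proof.
move=> oU f0 sf i k.
apply: (@differentiable_uptoV _ _ _ (chart_image U i) (f \o chart_param i)).
- exact: open_chart_image.
- by move=> z /chart_imageP[_ Uz _]; exact: f0.
- exact: sf.
Qed.

Lemma smooth_function_sqrt U f : open U -> (forall x, U x -> 0 < f x) ->
  smooth_function U f -> smooth_function U (fun x => Num.sqrt (f x)).
Proof.
move=> oU f0 sf i k.
apply: (@differentiable_upto_sqrt _ _ _ (chart_image U i) (f \o chart_param i)).
- exact: open_chart_image.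
- by move=> z /chart_imageP[_ Uz _]; exact: f0.
- exact: sf.
Qed.

Lemma smooth_function_sum (I : Type) (r : seq I) (P : pred I) U
    (f : I -> M -> R) : open U -> (forall j, smooth_function U (f j)) ->
  smooth_function U (fun x => \sum_(j <- r | P j) f j x).
Proof.
move=> oU sf; elim: r => [|j r IH].
  apply: eq_smooth_function (smooth_function_cst U 0) => // x _.
  by rewrite big_nil.
case Pj: (P j); last first.
  by apply: eq_smooth_function IH => // x _; rewrite big_cons Pj.
apply: eq_smooth_function (smooth_functionD oU (sf j) IH) => // x _.
by rewrite big_cons Pj.
Qed.

(** Used to shrink neighbourhoods so that a quantity that is positive at one point can be inverted
    or put under a square root. *)
Lemma smooth_function_gt0 U f x : open U -> U x -> smooth_function U f ->
  0 < f x ->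
  exists U', [/\ open_nbhs x U', U' `<=` U & forall y, U' y -> 0 < f y].
Proof.
move=> oU Ux sf fx; have [i xi] := chart_dom_cover x.
have zU : chart_image U i (chart_coord i x) by exists x.
(* Order 1 of smoothness is enough: it gives continuity of [f] read in the chart. *)
have [/(_ _ zU) /differentiable_continuous cf _] := sf i 1%N.
have cx := chart_coord_continuous xi.
have cfx : {for x, continuous ((f \o chart_param i) \o chart_coord i)}.
  exact: continuous_comp cx cf.
have n1 : nbhs x [set y | 0 < f (chart_param i (chart_coord i y))].
  apply: (cfx [set r | 0 < r]); rewrite /= chart_coordK //.
  by apply: open_nbhs_nbhs; split => //; exact: open_gt.
have n2 : nbhs x (chart_dom i) by apply: open_nbhs_nbhs; split => //; exact:
  chart_dom_open.
have n3 : nbhs x U by exact: open_nbhs_nbhs.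
have /nbhs_interior n : nbhs x [set y | U y /\ 0 < f y].
  apply: filterS (filterI n1 (filterI n2 n3)) => y [/= fy [yi Uy]].
  by rewrite chart_coordK // in fy.
exists ([set y | U y /\ 0 < f y]^°); split.
- by split; [exact: open_interior|exact: nbhs_singleton n].
- by move=> y /interior_subset[].
- by move=> y /interior_subset[].
Qed.

Lemma tcoordD (x : M) (t t' : tangent x) i : (t + t') i = t i + t' i.
Proof. by []. Qed.

Lemma tcoordZ (x : M) (t : tangent x) (c : R) i : (c *: t) i = c *: t i.
Proof. by []. Qed.

Lemma eq_smooth_vector_field U X Y : open U -> (forall x, U x -> X x = Y x) ->
  smooth_vector_field U X -> smooth_vector_field U Y.
Proof.
move=> oU XY sX i k; apply: eq_differentiable_upto (sX i k).
  exact: open_chart_image.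
by move=> z /chart_imageP[_ Uz _]; rewrite XY.
Qed.

Lemma smooth_vector_field0 U : smooth_vector_field U (fun x : M => 0).
Proof. by move=> i k; exact: (differentiable_upto_cst k _ (0 : 'rV[R]_m)). Qed.

Lemma smooth_vector_fieldD U X Y : open U ->
  smooth_vector_field U X -> smooth_vector_field U Y ->
  smooth_vector_field U (fun x => X x + Y x).
Proof.
move=> oU sX sY i k.
exact: differentiable_uptoD (open_chart_image oU) (sX i k) (sY i k).
Qed.

Lemma smooth_vector_fieldZ U f X : open U ->
  smooth_function U f -> smooth_vector_field U X ->
  smooth_vector_field U (fun x => f x *: X x).
Proof.
move=> oU sf sX i k.
exact: (@differentiable_upto_scale _ _ _ k _ (f \o chart_param i)
  _ (open_chart_image oU) (sf i k) (sX i k)).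
Qed.

Lemma smooth_vector_field_sum (I : Type) (r : seq I) U
    (X : I -> forall x : M, tangent x) : open U ->
  (forall j, smooth_vector_field U (X j)) ->
  smooth_vector_field U (fun x => \sum_(j <- r) X j x).
Proof.
move=> oU sX; elim: r => [|j r IH].
  by apply: eq_smooth_vector_field (smooth_vector_field0 U) => // x _; rewrite
    big_nil.
apply: eq_smooth_vector_field (smooth_vector_fieldD oU (sX j) IH) => // x _.
by rewrite big_cons.
Qed.

(** Coordinates in the other charts at [x] are linear images of those in chart [i], and away from
    [x] they are 0 by convention. *)
Lemma tangent_inj (x : M) i : chart_dom i x ->
  forall t : tangent x, t i = 0 -> t = 0.
Proof.
move=> xi t ti; apply: val_inj; apply/funext => j /=.
have /asboolP[t1 t2] := tcoordP t.
have [xj|xj] := pselect (chart_dom j x); last exact: t2.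
by rewrite (t1 i j xi xj) ti linear0.
Qed.

End ManifoldCalculus.

(** * Quaternions *)

Section Quaternions.
Variable R : realType.
Implicit Types (p q : quat R) (c : R).

Lemma quat_addE a b c d a' b' c' d' :
  Quat a b c d + Quat a' b' c' d' =
  Quat (a + a') (b + b') (c + c') (d + d') :> quat R.
Proof. by []. Qed.

Lemma quat_oppE a b c d :
  - Quat a b c d = Quat (- a) (- b) (- c) (- d) :> quat R.
Proof. by []. Qed.

Lemma quat_mulE a b c d a' b' c' d' : Quat a b c d * Quat a' b' c' d' =
  Quat (a * a' - b * b' - c * c' - d * d') (a * b' + b * a' + c * d' - d * c')
       (a * c' - b * d' + c * a' + d * b') (a * d' + b * c' - c * b' + d * a')
  :> quat R.
Proof. by []. Qed.

Lemma quat_scaleE x a b c d :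
  x *: Quat a b c d = Quat (x * a) (x * b) (x * c) (x * d) :> quat R.
Proof. by []. Qed.

Lemma quat_conjE a b c d : quat_conj (Quat a b c d) = Quat a (- b) (- c) (- d)
  :> quat R.
Proof. by []. Qed.

Lemma quat_0E : 0 = Quat 0 0 0 0 :> quat R. Proof. by []. Qed.
Lemma quat_1E : 1 = Quat 1 0 0 0 :> quat R. Proof. by []. Qed.

Definition quatE := (quat_addE, quat_oppE, quat_mulE, quat_scaleE, quat_conjE,
  quat_0E, quat_1E).

Ltac quat_ring := rewrite ?quatE /=; congr Quat; ring.

Lemma quat_ext p q : qre p = qre q -> qi p = qi q -> qj p = qj q ->
  qk p = qk q -> p = q.
Proof. by case: p q => [????] [????] /= -> -> -> ->. Qed.

Definition quat_norm2 q := qre q ^+ 2 + qi q ^+ 2 + qj q ^+ 2 + qk q ^+ 2.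

Lemma quat_conjK : involutive (@quat_conj R).
Proof. by case=> [????]; quat_ring. Qed.

Lemma quat_conjZ c p : quat_conj (c *: p) = c *: quat_conj p.
Proof. by case: p => [????]; quat_ring. Qed.

Lemma quat_scalerAl c p q : c *: (p * q) = c *: p * q.
Proof. by case: p q => [????] [????]; quat_ring. Qed.

Lemma quat_scalerAr c p q : c *: (p * q) = p * (c *: q).
Proof. by case: p q => [????] [????]; quat_ring. Qed.

Lemma quat_conj_mul q : quat_conj q * q = quat_norm2 q *: (1 : quat R).
Proof. by case: q => [????]; rewrite /quat_norm2 /=; quat_ring. Qed.

Lemma quat_mul_conj q : q * quat_conj q = quat_norm2 q *: (1 : quat R).
Proof. by case: q => [????]; rewrite /quat_norm2 /=; quat_ring. Qed.

Lemma quat_norm2_ge0 q : 0 <= quat_norm2 q.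
Proof. by rewrite !addr_ge0 // sqr_ge0. Qed.

Lemma quat_norm2_gt0 q : (0 < quat_norm2 q) = (q != 0).
Proof.
rewrite lt0r quat_norm2_ge0 andbT; congr negb; apply/eqP/eqP => [|->]; last
  first.
  by rewrite /quat_norm2 /= expr0n /= !addr0.
move/eqP; rewrite !paddr_eq0 ?addr_ge0 ?sqr_ge0 // !sqrf_eq0.
by move=> /andP[/andP[/andP[/eqP a0 /eqP b0] /eqP c0] /eqP d0]; exact: quat_ext.
Qed.

Definition quat_inv q := (quat_norm2 q)^-1 *: quat_conj q.

Lemma quat_mulV q : q != 0 -> q * quat_inv q = 1.
Proof.
rewrite -quat_norm2_gt0 => q0.
by rewrite -quat_scalerAr quat_mul_conj scalerA mulVf ?scale1r ?gt_eqF.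
Qed.

Lemma quat_Vmul q : q != 0 -> quat_inv q * q = 1.
Proof.
rewrite -quat_norm2_gt0 => q0.
by rewrite -quat_scalerAl quat_conj_mul scalerA mulVf ?scale1r ?gt_eqF.
Qed.

Lemma quat_inv_neq0 q : q != 0 -> quat_inv q != 0.
Proof.
move=> q0; apply/eqP => qV; have := quat_mulV q0.
by rewrite qV mulr0 => /eqP; rewrite eq_sym oner_eq0.
Qed.

Lemma quat_mul_neq0 p q : p != 0 -> q != 0 -> p * q != 0.
Proof.
move=> p0 q0; apply/eqP => pq; have := congr1 (fun r => r * quat_inv q) pq.
by rewrite -mulrA quat_mulV // mulr1 mul0r => /eqP; apply/negP.
Qed.

Definition quat_i : quat R := Quat 0 1 0 0.

Lemma quat_i_sqr : quat_i * quat_i = -1. Proof. by quat_ring. Qed.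

(* Up to a real factor, [quat_rot p] is the quaternion conjugating the unit
   imaginary quaternion [p / |p|] to [i]; on imaginary quaternions it vanishes
   only at the nonpositive multiples of [i]. *)
Definition quat_rot p := Num.sqrt (quat_norm2 p) *: (1 : quat R) - p * quat_i.

Definition quat_normalizer p :=
  (Num.sqrt (Num.sqrt (quat_norm2 p) * quat_norm2 (quat_rot p)))^-1 *: quat_rot
    p.

(** Put [r = |p|] and [q = quat_rot p = r - p i]. Since [p] is imaginary, [p^2 = - r^2], whence
    [p q = r q i] and [conj q p q = r |q|^2 i]. The normalizer is [q] divided by the square root of
    [r |q|^2]. *)
Lemma quat_normalizerP p : qre p = 0 -> p != 0 -> quat_rot p != 0 ->
  quat_conj (quat_normalizer p) * p * quat_normalizer p = quat_i.
Proof.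
move=> p0 pn0 qn0.
have r0 : 0 < Num.sqrt (quat_norm2 p) by rewrite sqrtr_gt0 quat_norm2_gt0.
have q0 : 0 < quat_norm2 (quat_rot p) by rewrite quat_norm2_gt0.
set N := Num.sqrt (quat_norm2 p) * quat_norm2 (quat_rot p).
have N0 : 0 < N by rewrite mulr_gt0.
rewrite /quat_normalizer -/N quat_conjZ -!quat_scalerAl -quat_scalerAr scalerA.
have -> : (Num.sqrt N)^-1 * (Num.sqrt N)^-1 = N^-1.
  by rewrite -invfM -expr2 sqr_sqrtr // ltW.
suff -> : quat_conj (quat_rot p) * p * quat_rot p = N *: quat_i.
  by rewrite scalerA mulVf ?scale1r // gt_eqF.
have -> : quat_conj (quat_rot p) * p * quat_rot p =
    quat_conj (quat_rot p) * (Num.sqrt (quat_norm2 p) *: (quat_rot p * quat_i)).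
  rewrite -mulrA; congr (_ * _).
  have := @sqr_sqrtr _ (quat_norm2 p) (quat_norm2_ge0 p).
  rewrite /quat_rot; move: (Num.sqrt _) => r rE.
  case: p p0 rE {pn0 qn0 r0 q0 N N0} => [a b c d] /= -> rE.
  rewrite /quat_norm2 /= expr0n add0r in rE; rewrite /quat_i ?quatE /=.
  congr Quat; ring: rE.
rewrite -quat_scalerAr mulrA quat_conj_mul -quat_scalerAl mul1r scalerA.
by [].
Qed.

End Quaternions.

(** * Right quaternionic vectors and their real coordinates *)

Section QuaternionicVectors.
Variable R : realType.
Implicit Types (p q : quat R) (c : R).

Definition hcoord n (v : Hn R n) (a : 'I_n) : quat R :=
  (v : {ffun 'I_n -> quat R}) a.

Definition hvec n (c : 'I_n -> quat R) : Hn R n := [ffun a => c a].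

Lemma hcoord_vec n (c : 'I_n -> quat R) a : hcoord (hvec c) a = c a.
Proof. by rewrite /hcoord ffunE. Qed.

Lemma hvecP n (v w : Hn R n) : (forall a, hcoord v a = hcoord w a) -> v = w.
Proof. by move=> vw; apply/ffunP. Qed.

Lemma hcoordD n (v w : Hn R n) a : hcoord (v + w) a = hcoord v a + hcoord w a.
Proof. by rewrite /hcoord ffunE. Qed.

Lemma hcoordN n (v : Hn R n) a : hcoord (- v) a = - hcoord v a.
Proof. by rewrite /hcoord ffunE. Qed.

Lemma hcoord0 n a : hcoord (0 : Hn R n) a = 0.
Proof. by rewrite /hcoord ffunE. Qed.

Lemma hcoordZ n c (v : Hn R n) a : hcoord (c *: v) a = c *: hcoord v a.
Proof. by rewrite /hcoord ffunE. Qed.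

Lemma hcoord_rscale n (v : Hn R n) q a : hcoord (rscale v q) a = hcoord v a * q.
Proof. by rewrite /hcoord ffunE. Qed.

Lemma hcoord_sum n (I : Type) (r : seq I) (v : I -> Hn R n) a :
  hcoord (\sum_(j <- r) v j) a = \sum_(j <- r) hcoord (v j) a.
Proof.
by elim: r => [|j r IH]; rewrite ?big_nil ?hcoord0 // !big_cons hcoordD IH.
Qed.

Lemma rscaleDl n (v w : Hn R n) q : rscale (v + w) q = rscale v q + rscale w q.
Proof. by apply: hvecP => a; rewrite !(hcoordD, hcoord_rscale) mulrDl. Qed.

Lemma rscaleDr n (v : Hn R n) p q : rscale v (p + q) = rscale v p + rscale v q.
Proof. by apply: hvecP => a; rewrite !(hcoordD, hcoord_rscale) mulrDr. Qed.

Lemma rscaleA n (v : Hn R n) p q : rscale (rscale v p) q = rscale v (p * q).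
Proof. by apply: hvecP => a; rewrite !hcoord_rscale mulrA. Qed.

Lemma rscale1 n (v : Hn R n) : rscale v 1 = v.
Proof. by apply: hvecP => a; rewrite hcoord_rscale mulr1. Qed.

Lemma rscaler0 n (v : Hn R n) : rscale v 0 = 0.
Proof. by apply: hvecP => a; rewrite hcoord_rscale hcoord0 mulr0. Qed.

Lemma rscale0r n q : rscale (0 : Hn R n) q = 0.
Proof. by apply: hvecP => a; rewrite hcoord_rscale hcoord0 mul0r. Qed.

Lemma rscaleZl n c (v : Hn R n) q : rscale (c *: v) q = c *: rscale v q.
Proof.
by apply: hvecP => a; rewrite !(hcoordZ, hcoord_rscale) quat_scalerAl.
Qed.

Lemma rscaleZr n c (v : Hn R n) q : rscale v (c *: q) = c *: rscale v q.
Proof.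
by apply: hvecP => a; rewrite !(hcoordZ, hcoord_rscale) quat_scalerAr.
Qed.

Lemma rscale_suml n (I : Type) (r : seq I) (v : I -> Hn R n) q :
  rscale (\sum_(j <- r) v j) q = \sum_(j <- r) rscale (v j) q.
Proof.
by elim: r => [|j r IH]; rewrite ?big_nil ?rscale0r // !big_cons rscaleDl IH.
Qed.

Definition hbasis n (a : 'I_n) : Hn R n := hvec (fun b => (b == a)%:R).

Lemma hbasis_sum n (v : Hn R n) : v = \sum_a rscale (hbasis a) (hcoord v a).
Proof.
apply: hvecP => b; rewrite hcoord_sum (bigD1 b) //= hcoord_rscale hcoord_vec.
rewrite eqxx mul1r big1 ?addr0 // => a ab.
by rewrite hcoord_rscale hcoord_vec eq_sym (negbTE ab) mul0r.
Qed.

Definition qcomp (c : 'I_4) q : R := [tuple qre q; qi q; qj q; qk q]`_c.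

(** Flattening to real row vectors makes matrix rank and invertibility available for maps that are
    merely real linear. *)
Definition rv n (v : Hn R n) : 'rV[R]_(4 * n) :=
  mxvec (\matrix_(c < 4, a < n) qcomp c (hcoord v a)).

Definition vr n (u : 'rV[R]_(4 * n)) : Hn R n :=
  hvec (fun a => Quat (vec_mx u (inord 0) a) (vec_mx u (inord 1) a)
                      (vec_mx u (inord 2) a) (vec_mx u (inord 3) a)).

Lemma rvK n : cancel (@rv n) (@vr n).
Proof.
move=> v; apply: hvecP => a; rewrite hcoord_vec /rv mxvecK !mxE.
by rewrite /qcomp !inordK //=; case: (hcoord v a).
Qed.

Lemma vrK n : cancel (@vr n) (@rv n).
Proof.
move=> u; rewrite /rv -[RHS]vec_mxK; congr mxvec; apply/matrixP => c a.
rewrite [LHS]mxE hcoord_vec /qcomp; case: c => [[|[|[|[|]]]] c] //=;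
by congr (vec_mx u _ _); apply: val_inj; rewrite /= inordK.
Qed.

Lemma qcompD i p q : qcomp i (p + q) = qcomp i p + qcomp i q.
Proof. by case: i => [[|[|[|[|]]]] ?]. Qed.

Lemma qcompZ i c q : qcomp i (c *: q) = c * qcomp i q.
Proof. by case: i => [[|[|[|[|]]]] ?]. Qed.

Lemma rv_linear n : linear (@rv n).
Proof.
move=> c v w; rewrite /rv -linearP; congr mxvec; apply/matrixP => i a.
by rewrite !mxE hcoordD hcoordZ qcompD qcompZ.
Qed.

HB.instance Definition _ n := GRing.isLinear.Build R (Hn R n) _ _ (@rv n)
  (@rv_linear n).

Lemma vr_linear n : linear (@vr n).
Proof.
by move=> c v w; apply: (can_inj (@rvK n)); rewrite rv_linear !vrK.
Qed.

HB.instance Definition _ n := GRing.isLinear.Build R _ (Hn R n) _ (@vr n)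
  (@vr_linear n).

Definition rbasis n (k : 'I_(4 * n)) : Hn R n := vr (delta_mx 0 k).

Lemma rbasis_sum n (v : Hn R n) : v = \sum_k rv v 0 k *: rbasis k.
Proof.
rewrite -{1}[v]rvK [rv v in LHS]row_sum_delta linear_sum.
by apply: eq_bigr => k _; rewrite linearZ.
Qed.

Lemma hlinear_mx n k (f : Hn R n -> Hn R k) : linear f ->
  exists S : 'M[R]_(4 * n, 4 * k), forall v, rv (f v) = rv v *m S.
Proof.
move=> lf; pose fM := GRing.isLinear.Build R (Hn R n) (Hn R k) _ f lf.
pose fL : {linear Hn R n -> Hn R k} := HB.pack f fM.
pose g : {linear _ -> _} := @rv k \o fL \o @vr n.
by exists (lin1_mx g) => v; rewrite mul_rV_lin1 /= rvK.
Qed.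

(** The real matrix of [f] has rank at most [4 k < 4 n], so its kernel is nonzero. *)
Lemma hlinear_ker n k (f : Hn R n -> Hn R k) : linear f -> (k < n)%N ->
  exists2 v, v != 0 & f v = 0.
Proof.
move=> lf kn; have [S SE] := hlinear_mx lf.
have : kermx S != 0.
  rewrite -mxrank_eq0 mxrank_ker -lt0n subn_gt0.
  by rewrite (leq_ltn_trans (rank_leq_col S)) // ltn_pmul2l.
case/rowV0Pn => u /sub_kermxP uS u0; exists (vr u).
  by apply: contraNneq u0 => vu; rewrite -[u]vrK vu linear0.
by apply: (can_inj (@rvK k)); rewrite SE vrK uS linear0.
Qed.

(** In real coordinates both maps are square matrices, for which a one-sided inverse is
    two-sided. *)
Lemma hlinear_cancel n (f g : Hn R n -> Hn R n) : linear f -> linear g ->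
  cancel f g -> cancel g f.
Proof.
move=> /hlinear_mx[S SE] /hlinear_mx[T TE] fg v.
have ST : S *m T = 1%:M.
  apply/row_matrixP => i; rewrite !rowE mulmx1 mulmxA.
  by rewrite -[delta_mx 0 i]vrK -SE -TE fg.
apply: (can_inj (@rvK n)).
by rewrite SE TE -mulmxA (mulmx1C ST) mulmx1.
Qed.

End QuaternionicVectors.

(** * Quaternionically skew-Hermitian forms *)

Section SkewHermitian.
Variables (R : realType) (n : nat) (Om : Hn R n -> Hn R n -> quat R).
Hypothesis OmP : quat_skew_hermitian (@rscale R n) Om.
Local Notation "''I'" := (quat_i R).

Lemma qsh_rscalel v w q : Om (rscale v q) w = quat_conj q * Om v w.
Proof. by case: OmP. Qed.

Lemma qsh_rscaler v w q : Om v (rscale w q) = Om v w * q.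
Proof. by case: OmP. Qed.

Lemma qsh_skew v w : Om w v = - quat_conj (Om v w).
Proof. by case: OmP. Qed.

Lemma qshPr v w c w' : Om v (c *: w + w') = c *: Om v w + Om v w'.
Proof. by case: OmP => -[_ /(_ v c w w')]. Qed.

Lemma qshPl v c w w' : Om (c *: w + w') v = c *: Om w v + Om w' v.
Proof. by case: OmP => -[/(_ v c w w')]. Qed.

Lemma qshDr v w w' : Om v (w + w') = Om v w + Om v w'.
Proof. by rewrite -[w]scale1r qshPr !scale1r. Qed.

Lemma qshDl v w w' : Om (w + w') v = Om w v + Om w' v.
Proof. by rewrite -[w]scale1r qshPl !scale1r. Qed.

Lemma qsh0r v : Om v 0 = 0.
Proof. by apply: (addrI (Om v 0)); rewrite -qshDr !addr0. Qed.

Lemma qsh0l v : Om 0 v = 0.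
Proof. by apply: (addrI (Om 0 v)); rewrite -qshDl !addr0. Qed.

Lemma qshNr v w : Om v (- w) = - Om v w.
Proof. by apply: (addrI (Om v w)); rewrite -qshDr !subrr qsh0r. Qed.

Lemma qsh_sumr (I : Type) (r : seq I) v (F : I -> Hn R n) :
  Om v (\sum_(j <- r) F j) = \sum_(j <- r) Om v (F j).
Proof.
by elim: r => [|j r IH]; rewrite ?big_nil ?qsh0r // !big_cons qshDr IH.
Qed.

Lemma qsh_suml (I : Type) (r : seq I) v (F : I -> Hn R n) :
  Om (\sum_(j <- r) F j) v = \sum_(j <- r) Om (F j) v.
Proof.
by elim: r => [|j r IH]; rewrite ?big_nil ?qsh0l // !big_cons qshDl IH.
Qed.

Lemma qsh_diag v : qre (Om v v) = 0.
Proof.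
have := congr1 (@qre R) (qsh_skew v v); case: (Om v v) => [a b c d] /= aN.
by lra.
Qed.

(** The form is polynomial in its Gram matrix and the coordinates of its arguments; this reduces
    smoothness of a family of forms to that of the Gram matrix. *)
Lemma qsh_coord v w :
  Om v w = \sum_a \sum_b
    quat_conj (hcoord v a) * Om (hbasis R a) (hbasis R b) * hcoord w b.
Proof.
rewrite {1}[v]hbasis_sum qsh_suml; apply: eq_bigr => a _.
rewrite {1}[w]hbasis_sum qsh_sumr; apply: eq_bigr => b _.
by rewrite qsh_rscalel qsh_rscaler mulrA.
Qed.

(** Values on the diagonal are imaginary, so the unit [i] takes the place of 1 in the
    normalization. *)
Definition orthonormal_family k (f : 'I_k -> Hn R n) :=
  forall a b, Om (f a) (f b) = if a == b then 'I else 0.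

Lemma quat_mulNii (q : quat R) : 'I * (- 'I * q) = q.
Proof. by rewrite mulrA mulrN quat_i_sqr opprK mul1r. Qed.

Section Family.
Variables (k : nat) (f : 'I_k -> Hn R n).
Hypothesis fP : orthonormal_family f.

Definition hcomb (c : 'I_k -> quat R) : Hn R n := \sum_a rscale (f a) (c a).

Lemma qsh_comb a c : Om (f a) (hcomb c) = 'I * c a.
Proof.
rewrite qsh_sumr (bigD1 a) //= qsh_rscaler fP eqxx big1 ?addr0 // => b ba.
by rewrite qsh_rscaler fP eq_sym (negbTE ba) mul0r.
Qed.

Lemma qsh_comb2 c d :
  Om (hcomb c) (hcomb d) = \sum_a quat_conj (c a) * ('I * d a).
Proof.
by rewrite {1}/hcomb qsh_suml; apply: eq_bigr => a _; rewrite qsh_rscalel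
  qsh_comb.
Qed.

(** The coefficients [c] solve [Om (f a) (hcomb c) = Om (f a) v]: by [qsh_comb] the left side is
    [i * c a], and [i * (- i) = 1]. *)
Definition orth_part (v : Hn R n) := v - hcomb (fun a => - 'I * Om (f a) v).

Lemma orth_partP a v : Om (f a) (orth_part v) = 0.
Proof. by rewrite qshDr qshNr qsh_comb quat_mulNii subrr. Qed.

Lemma orth_part_id v : (forall a, Om (f a) v = 0) -> orth_part v = v.
Proof.
move=> fv; rewrite /orth_part /hcomb big1 ?subr0 // => a _.
by rewrite fv mulr0 rscaler0.
Qed.

Lemma nonisotropic_complement : nondegenerate_form Om -> (k < n)%N ->
  exists v, (forall a, Om (f a) v = 0) /\ Om v v != 0.
Proof.
move=> nd kn; pose T v : Hn R k := hvec (fun a => Om (f a) v).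
(* [T] goes from [H^n] to [H^k] with [k < n], so it kills some [v != 0]; its kernel is the
   orthogonal complement of the family. *)
have lT : linear T.
  move=> c v w; apply: hvecP => a.
  by rewrite hcoordD hcoordZ !hcoord_vec qshPr.
have [v v0 Tv] := hlinear_ker lT kn.
have fv a : Om (f a) v = 0 by rewrite -(hcoord_vec (fun a => Om (f a) v)) -/(T
  v) Tv hcoord0.
apply: contrapT => iso; case/eqP: v0; apply: nd => w.
(* If every vector of the complement is isotropic, polarization makes the form
   real-valued on the complement, hence zero as it is right H-linear. *)
have isoE u : (forall a, Om (f a) u = 0) -> Om u u = 0.
  by move=> fu; apply/eqP; apply: contra_notT iso => uu; exists u.
have real u u' : (forall a, Om (f a) u = 0) -> (forall a, Om (f a) u' = 0) ->
    Om u u' = quat_conj (Om u u').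
  move=> fu fu'; have : Om (u + u') (u + u') = 0.
    by apply: isoE => a; rewrite qshDr fu fu' addr0.
  rewrite qshDl !qshDr !isoE // add0r addr0 (qsh_skew u u') => /eqP.
  by rewrite subr_eq0 => /eqP.
have iso0 u : (forall a, Om (f a) u = 0) -> Om v u = 0.
  move=> fu; have H q : Om v u * q = quat_conj (Om v u * q).
    by rewrite -qsh_rscaler; apply: real => // a; rewrite qsh_rscaler fu mul0r.
  (* With [q = 1] the value is real; with [q = i] its product by [i] is real as well, so it is 0. *)
  move: (H 1) (H (Quat 0 1 0 0)); rewrite !mulr1; case: (Om v u) => a b c d.
  rewrite !quatE => -[b0 c0 d0] -[]; rewrite !mulr0 !mulr1 => a0 _ _.
  by apply: quat_ext => /=; lra.
(* Every [w] is the sum of a vector of the complement and one of the span of [f]. The vector [v]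
   pairs to 0 with both, so it lies in the radical. *)
have -> : w = orth_part w + hcomb (fun a => - 'I * Om (f a) w) by rewrite subrK.
rewrite qshDr iso0 ?add0r; last by move=> a; exact: orth_partP.
rewrite qsh_sumr big1 // => a _.
by rewrite qsh_rscaler (qsh_skew (f a)) fv -[0]/(Quat 0 0 0 0) quatE oppr0
  quatE !oppr0 mul0r.
Qed.

End Family.

(** Reading off coefficients ([E]) is a left inverse of forming combinations ([F]). Both are real
    linear on [H^n], so they are mutually inverse and [f] is a basis. *)
Lemma qsh_expand (f : 'I_n -> Hn R n) : orthonormal_family f ->
  forall v, v = hcomb f (fun a => - 'I * Om (f a) v).
Proof.
move=> fP v.
pose E v : Hn R n := hvec (fun a => - 'I * Om (f a) v).
pose F c : Hn R n := hcomb f (hcoord c).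
have lE : linear E.
  move=> c w w'; apply: hvecP => a.
  by rewrite hcoordD hcoordZ !hcoord_vec qshPr mulrDr quat_scalerAr.
have lF : linear F.
  move=> c w w'; rewrite /F /hcomb scaler_sumr -big_split; apply: eq_bigr => a
    _.
  by rewrite hcoordD hcoordZ rscaleDr rscaleZr.
have FE : cancel F E.
  move=> c; apply: hvecP => a; rewrite hcoord_vec qsh_comb //.
  by rewrite mulrA mulNr quat_i_sqr opprK mul1r.
rewrite -{1}(hlinear_cancel lF lE FE v) /F /hcomb; apply: eq_bigr => a _.
by rewrite hcoord_vec.
Qed.

End SkewHermitian.

Lemma quat_rot_conj (R : realType) (p : quat R) : qre p = 0 -> p != 0 ->
  exists2 q, q != 0 & quat_rot (quat_conj q * p * q) != 0.
Proof.
move=> p0 pn0; have [r0|r0] := eqVneq (quat_rot p) 0; last first.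
  exists 1; first exact: oner_neq0.
  by rewrite mulr1 [quat_conj _](_ : _ = 1) ?mul1r // quat_1E quatE oppr0.
(* If [quat_rot p = 0], then [p] is a negative multiple of [i]. Conjugation by [j] turns it into a
   positive multiple, on which [quat_rot] does not vanish. *)
exists (Quat 0 0 1 0); first by apply/eqP => -[] /eqP; rewrite oner_eq0.
have : 0 < quat_norm2 p by rewrite quat_norm2_gt0.
move: r0; rewrite /quat_rot /quat_i.
case: p p0 pn0 => [a b c d] /= -> _; rewrite /quat_norm2 /= !quatE => -[].
set r := Num.sqrt _ => rb _ rd rc n0.
have r0 : 0 < r by rewrite sqrtr_gt0.
apply/eqP => -[]; set s := Num.sqrt _ => sb _ _ _.
have s0 : 0 <= s := sqrtr_ge0 _.
move: rb rd rc sb; clearbody r s; rewrite !(mulr0, mul0r, mulr1, mul1r) => *.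
lra.
Qed.

(** * Isometry between two forms given by orthonormal bases *)

Section FrameChange.
Variables (R : realType) (n : nat) (Om Om' : Hn R n -> Hn R n -> quat R).
Hypotheses (OmP : quat_skew_hermitian (@rscale R n) Om)
  (OmP' : quat_skew_hermitian (@rscale R n) Om').
Variables f g : 'I_n -> Hn R n.
Hypotheses (fP : orthonormal_family Om f) (gP : orthonormal_family Om' g).

(** By [qsh_expand] the coefficients are the coordinates of [v] in the basis [g], so this is the
    H-linear map taking [g a] to [f a]. *)
Definition frame_change (v : Hn R n) : Hn R n :=
  hcomb f (fun a => - quat_i R * Om' (g a) v).

Lemma frame_change_linear : linear frame_change.
Proof.
move=> c v w; rewrite /frame_change /hcomb scaler_sumr -big_split.
apply: eq_bigr => a _.
by rewrite (qshPr OmP') mulrDr -quat_scalerAr rscaleDr rscaleZr.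
Qed.

Lemma frame_change_rscale v q : frame_change (rscale v q) = rscale
  (frame_change v) q.
Proof.
rewrite /frame_change /hcomb rscale_suml; apply: eq_bigr => a _.
by rewrite (qsh_rscaler OmP') rscaleA mulrA.
Qed.

(** Both forms are given by the same expression [qsh_comb2] in coordinates with respect to an
    orthonormal basis. *)
Lemma frame_change_form v w : Om (frame_change v) (frame_change w) = Om' v w.
Proof.
rewrite (qsh_comb2 OmP fP) {2}(qsh_expand OmP' gP v) {2}(qsh_expand OmP' gP w).
by rewrite (qsh_comb2 OmP' gP).
Qed.

End FrameChange.

Lemma frame_changeK (R : realType) (n : nat) (Om Om' : Hn R n -> Hn R n -> quat
  R)
    (f g : 'I_n -> Hn R n) :
  quat_skew_hermitian (@rscale R n) Om -> quat_skew_hermitian (@rscale R n) Om'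
    ->
  orthonormal_family Om f -> orthonormal_family Om' g ->
  cancel (frame_change Om' f g) (frame_change Om g f).
Proof.
move=> OmP OmP' fP gP v; rewrite [RHS](qsh_expand OmP' gP).
apply: eq_bigr => a _; congr (rscale _ (_ * _)).
by rewrite (qsh_comb OmP fP) quat_mulNii.
Qed.

(** * Smooth families of skew-Hermitian forms *)

Section SmoothQuaternionic.
Variables (R : realType) (m : nat) (M : smoothManifold R m).
Implicit Types (U : set M) (p q : M -> quat R).

Definition smooth_quat U q :=
  [/\ smooth_function U (fun y => qre (q y)), smooth_function U (fun y => qi (q
    y)),
      smooth_function U (fun y => qj (q y)) & smooth_function U (fun y => qk (q
        y))].

Lemma eq_smooth_quat U p q : open U -> (forall y, U y -> p y = q y) ->
  smooth_quat U p -> smooth_quat U q.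
Proof.
by move=> oU pq [s0 s1 s2 s3]; split;
  [apply: (eq_smooth_function oU _ s0)|apply: (eq_smooth_function oU _ s1)
  |apply: (eq_smooth_function oU _ s2)|apply: (eq_smooth_function oU _ s3)]
  => y Uy /=; rewrite pq.
Qed.

Lemma sub_smooth_quat U U' q : U' `<=` U -> smooth_quat U q -> smooth_quat U' q.
Proof. by move=> UU [? ? ? ?]; split; exact: (sub_smooth_function UU). Qed.

Lemma smooth_quat_cst U (c : quat R) : smooth_quat U (fun=> c).
Proof. by split; exact: smooth_function_cst. Qed.

Lemma smooth_quatD U p q : open U -> smooth_quat U p -> smooth_quat U q ->
  smooth_quat U (fun y => p y + q y).
Proof. by move=> oU [? ? ? ?] [? ? ? ?]; split; exact: smooth_functionD. Qed.

Lemma smooth_quatN U q : open U -> smooth_quat U q ->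
  smooth_quat U (fun y => - q y).
Proof. by move=> oU [? ? ? ?]; split; exact: smooth_functionN. Qed.

Lemma smooth_quatM U p q : open U -> smooth_quat U p -> smooth_quat U q ->
  smooth_quat U (fun y => p y * q y).
Proof.
move=> oU [p0 p1 p2 p3] [q0 q1 q2 q3].
(* The product reduces only on constructors, so both factors are first rebuilt from their
   components. *)
have pq y : p y * q y =
    Quat (qre (p y)) (qi (p y)) (qj (p y)) (qk (p y)) *
    Quat (qre (q y)) (qi (q y)) (qj (q y)) (qk (q y)) by case: (p y) (q y) =>
      [????] [].
split; under eq_fun do rewrite pq quat_mulE /=;
  by repeat first [apply: (smooth_functionD oU) | apply: (smooth_functionN oU)
                  | apply: (smooth_functionM oU)].
Qed.

Lemma smooth_quat_conj U q : open U -> smooth_quat U q ->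
  smooth_quat U (fun y => quat_conj (q y)).
Proof.
by move=> oU [? ? ? ?]; split=> //; exact: (smooth_functionN oU).
Qed.

Lemma smooth_quatZ U (c : M -> R) q : open U -> smooth_function U c ->
  smooth_quat U q -> smooth_quat U (fun y => c y *: q y).
Proof. by move=> oU sc [? ? ? ?]; split; exact: (smooth_functionM oU sc). Qed.

Lemma smooth_quat_norm2 U q : open U -> smooth_quat U q ->
  smooth_function U (fun y => quat_norm2 (q y)).
Proof.
move=> oU [? ? ? ?]; rewrite /quat_norm2; under eq_fun do rewrite !expr2.
by repeat first [apply: (smooth_functionD oU) | apply: (smooth_functionM oU)].
Qed.

Lemma smooth_quat_sum (I : Type) (r : seq I) U (q : I -> M -> quat R) : open U
  ->
  (forall j, smooth_quat U (q j)) -> smooth_quat U (fun y => \sum_(j <- r) q j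
    y).
Proof.
move=> oU sq; elim: r => [|j r IH].
  by apply: eq_smooth_quat (smooth_quat_cst U 0) => // y _; rewrite big_nil.
apply: eq_smooth_quat (smooth_quatD oU (sq j) IH) => // y _.
by rewrite big_cons.
Qed.

Lemma smooth_quat_rot U q : open U -> (forall y, U y -> 0 < quat_norm2 (q y)) ->
  smooth_quat U q -> smooth_quat U (fun y => quat_rot (q y)).
Proof.
move=> oU q0 sq; apply: smooth_quatD => //.
  apply: (smooth_quatZ oU); last exact: smooth_quat_cst.
  by apply: smooth_function_sqrt => //; exact: smooth_quat_norm2.
apply: (smooth_quatN oU); apply: (smooth_quatM oU sq); exact: smooth_quat_cst.
Qed.

Lemma smooth_quat_normalizer U q : open U ->
  (forall y, U y -> 0 < quat_norm2 (q y)) ->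
  (forall y, U y -> 0 < quat_norm2 (quat_rot (q y))) ->
  smooth_quat U q -> smooth_quat U (fun y => quat_normalizer (q y)).
Proof.
move=> oU q0 r0 sq; have sr := smooth_quat_rot oU q0 sq.
have N0 y : U y ->
    0 < Num.sqrt (quat_norm2 (q y)) * quat_norm2 (quat_rot (q y)).
  by move=> Uy; rewrite mulr_gt0 ?r0 // sqrtr_gt0 q0.
apply: (smooth_quatZ oU) => //; apply: (smooth_functionV oU).
  by move=> y Uy; rewrite gt_eqF // sqrtr_gt0 N0.
apply: (smooth_function_sqrt oU N0); apply: (smooth_functionM oU).
  by apply: (smooth_function_sqrt oU q0); exact: smooth_quat_norm2.
exact: smooth_quat_norm2.
Qed.

Variable n : nat.
Implicit Types v w : M -> Hn R n.

Definition smooth_hvec U v := forall a, smooth_quat U (fun y => hcoord (v y) a).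

Lemma sub_smooth_hvec U U' v : U' `<=` U -> smooth_hvec U v -> smooth_hvec U' v.
Proof. by move=> UU sv a; exact: sub_smooth_quat (sv a). Qed.

Lemma smooth_hvec_cst U (c : Hn R n) : smooth_hvec U (fun=> c).
Proof. by move=> a; exact: smooth_quat_cst. Qed.

Lemma smooth_hvecD U v w : open U -> smooth_hvec U v -> smooth_hvec U w ->
  smooth_hvec U (fun y => v y + w y).
Proof.
move=> oU sv sw a; under eq_fun do rewrite hcoordD; exact: smooth_quatD.
Qed.

Lemma smooth_hvecN U v : open U -> smooth_hvec U v ->
  smooth_hvec U (fun y => - v y).
Proof.
move=> oU sv a; under eq_fun do rewrite hcoordN; exact: smooth_quatN.
Qed.

Lemma smooth_hvec_rscale U v q : open U -> smooth_hvec U v -> smooth_quat U q ->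
  smooth_hvec U (fun y => rscale (v y) (q y)).
Proof.
move=> oU sv sq a; under eq_fun do rewrite hcoord_rscale; exact: smooth_quatM.
Qed.

Lemma smooth_hcomb U k (f : 'I_k -> M -> Hn R n) (c : 'I_k -> M -> quat R) :
  open U -> (forall a, smooth_hvec U (f a)) -> (forall a, smooth_quat U (c a))
    ->
  smooth_hvec U (fun y => hcomb (f^~ y) (c^~ y)).
Proof.
move=> oU sf sc b; under eq_fun do rewrite /hcomb hcoord_sum.
apply: smooth_quat_sum => // a; exact: (smooth_hvec_rscale oU (sf a) (sc a)).
Qed.

Lemma smooth_rv U v k : smooth_hvec U v -> smooth_function U (fun y => rv (v y)
  0 k).
Proof.
move=> sv; case/mxvec_indexP: k => c a.
under eq_fun do rewrite mxvecE mxE.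
by case: (sv a) => ? ? ? ?; case: c => [[|[|[|[|]]]] ?].
Qed.

(** * Gram-Schmidt for a smooth family of forms *)

Section GramSchmidt.
Variables (x : M) (U : set M) (Om : M -> Hn R n -> Hn R n -> quat R).
Hypotheses (Ux : open_nbhs x U)
  (OmP : forall y, U y -> quat_skew_hermitian (@rscale R n) (Om y))
  (Om_nd : forall y, U y -> nondegenerate_form (Om y))
  (Om_smooth : forall a b, smooth_quat U (fun y => Om y (hbasis R a) (hbasis R
    b))).

Lemma smooth_qsh U' v w : open U' -> U' `<=` U ->
  smooth_hvec U' v -> smooth_hvec U' w ->
  smooth_quat U' (fun y => Om y (v y) (w y)).
Proof.
move=> oU UU sv sw.
suff : smooth_quat U' (fun y => \sum_a \sum_b quat_conj (hcoord (v y) a) *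
    Om y (hbasis R a) (hbasis R b) * hcoord (w y) b).
  by apply: eq_smooth_quat => // y /UU /OmP /qsh_coord ->.
apply: smooth_quat_sum => // a; apply: smooth_quat_sum => // b.
apply: (smooth_quatM oU _ (sw b)); apply: (smooth_quatM oU).
  exact: smooth_quat_conj.
exact: sub_smooth_quat (Om_smooth a b).
Qed.

Lemma smooth_orthonormal_upto k : (k <= n)%N ->
  exists (U' : set M) (f : 'I_k -> M -> Hn R n),
    [/\ open_nbhs x U', U' `<=` U, forall a, smooth_hvec U' (f a)
      & forall y, U' y -> orthonormal_family (Om y) (f^~ y)].
Proof.
elim: k => [_|k IH kn].
  by exists U, (fun _ _ => 0); split=> // [[]|y _ []].
have [U' [f [[oU' U'x] UU sf fP]]] := IH (ltnW kn).
have Uxx := UU _ U'x.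
have [v0 [fv0 v0n]] := nonisotropic_complement (OmP Uxx) (fP _ U'x) (Om_nd Uxx)
  kn.
have [q q0 rq] := quat_rot_conj (qsh_diag (OmP Uxx) v0) v0n.
(* The constant vector [v] is chosen at [x] only: there it is orthogonal to the family, and its
   value under the form is not a nonpositive multiple of [i]. At nearby [y] it is projected to
   [w y]. *)
pose v := rscale v0 q.
pose w y := orth_part (Om y) (f^~ y) v.
pose p y := Om y (w y) (w y).
have sw : smooth_hvec U' w.
  apply: (smooth_hvecD oU'); first exact: smooth_hvec_cst.
  apply: (smooth_hvecN oU'); apply: (smooth_hcomb oU' sf) => a.
  apply: (smooth_quatM oU'); first exact: smooth_quat_cst.
  by apply: smooth_qsh => //; exact: smooth_hvec_cst.
have sp : smooth_quat U' p by exact: smooth_qsh.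
(* At [x] the projection leaves [v] unchanged. *)
have px : p x = quat_conj q * Om x v0 v0 * q.
  rewrite /p /w orth_part_id; last first.
    by move=> a; rewrite (qsh_rscaler (OmP Uxx)) fv0 mul0r.
  by rewrite (qsh_rscalel (OmP Uxx)) (qsh_rscaler (OmP Uxx)) mulrA.
have px0 : 0 < quat_norm2 (p x).
  rewrite quat_norm2_gt0 px !quat_mul_neq0 //.
  apply: contra_neq q0 => /(congr1 (@quat_conj R)); rewrite quat_conjK => ->.
  by rewrite quat_0E quatE oppr0.
(* The neighbourhood shrinks twice: first to keep [p] nonzero, which makes [|p|] and hence
   [quat_rot p] smooth, then to keep [quat_rot p] nonzero. *)
have [U1 [[oU1 U1x] UU1 p0]] :=
  smooth_function_gt0 oU' U'x (smooth_quat_norm2 oU' sp) px0.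
have sp1 := sub_smooth_quat UU1 sp.
have rx0 : 0 < quat_norm2 (quat_rot (p x)) by rewrite quat_norm2_gt0 px.
have [U2 [[oU2 U2x] UU2 r0]] := smooth_function_gt0 oU1 U1x
  (smooth_quat_norm2 oU1 (smooth_quat_rot oU1 p0 sp1)) rx0.
have UU3 : U2 `<=` U' by move=> y /UU2 /UU1.
pose g y := rscale (w y) (quat_normalizer (p y)).
(* The last index gets the new vector [g]; the others keep the old family. *)
exists U2, (fun a => if unlift ord_max a is Some b then f b else g).
split=> //; first by move=> y /UU3 /UU.
  move=> a; case: unliftP => [b _|_]; first exact: sub_smooth_hvec (sf b).
  apply: (smooth_hvec_rscale oU2); first exact: sub_smooth_hvec sw.
  apply: (smooth_quat_normalizer oU2) => //; first by move=> y /UU2 /p0.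
  exact: sub_smooth_quat sp1.
move=> y U2y; have U'y := UU3 _ U2y; have Uy := UU _ U'y.
have fg b : Om y (f b y) (g y) = 0.
  rewrite /g (qsh_rscaler (OmP Uy)) /w.
  by rewrite (orth_partP (OmP Uy) (fP _ U'y)) mul0r.
have gf b : Om y (g y) (f b y) = 0.
  by rewrite (qsh_skew (OmP Uy) (f b y)) fg quat_0E !quatE !oppr0.
move=> a b; case: unliftP => [a' ->|->]; case: unliftP => [b' ->|->].
- by rewrite fP // (inj_eq (@lift_inj _ _)).
- by rewrite fg eq_sym (negbTE (neq_lift _ _)).
- by rewrite gf (negbTE (neq_lift _ _)).
rewrite eqxx /g (qsh_rscalel (OmP Uy)) (qsh_rscaler (OmP Uy)) mulrA.
apply: quat_normalizerP; first exact: (qsh_diag (OmP Uy)).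
  by rewrite -quat_norm2_gt0; exact: p0 _ (UU2 _ U2y).
by rewrite -quat_norm2_gt0; exact: r0.
Qed.

Lemma smooth_orthonormal : exists (U' : set M) (f : 'I_n -> M -> Hn R n),
    [/\ open_nbhs x U', U' `<=` U, forall a, smooth_hvec U' (f a)
      & forall y, U' y -> orthonormal_family (Om y) (f^~ y)].
Proof. exact: smooth_orthonormal_upto. Qed.

End GramSchmidt.

End SmoothQuaternionic.

(** * Structure groups *)

Section StructureGroups.
Variables (R : realType) (n : nat).
Implicit Types (A B : Hn R n -> Hn R n) (G : set (Hn R n -> Hn R n)).

Definition transformation_group G :=
  [/\ G id, forall A B, G A -> G B -> G (A \o B)
    & forall A, G A -> exists B, [/\ G B, cancel A B & cancel B A]].

Lemma GLH_group : transformation_group (@GLH R n).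
Proof.
split; first by split=> //; exists id.
  move=> A B [lA bA hA] [lB bB hB]; split.
  - by move=> c v w /=; rewrite lB /=; exact: lA.
  - exact: bij_comp.
  - by move=> v q /=; rewrite hB hA.
move=> A [lA [B AB BA] hA]; exists B; split=> //; split.
- by move=> c v w; apply: (can_inj AB); rewrite lA !BA.
- by exists A.
- by move=> v q; apply: (can_inj AB); rewrite hA !BA.
Qed.

Lemma SOstar_group (omega : Hn R n -> Hn R n -> quat R) :
  transformation_group (SOstar omega).
Proof.
have [G1 GM GV] := GLH_group.
split; first by split.
  by move=> A B [gA oA] [gB oB]; split=> [|v w /=]; [exact: GM|rewrite oA oB].
move=> A [gA oA]; have [B [gB AB BA]] := GV A gA; exists B; split=> //.
by split=> // v w; rewrite -oA !BA.
Qed.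

(** Elements of [G] commute with right scalar multiplications, so products and inverses can be taken
    separately in the two factors. *)
Lemma Hstar_mul_group G : G `<=` @GLH R n -> transformation_group G ->
  transformation_group (Hstar_mul G).
Proof.
move=> GG [G1 GM GV]; split.
- exists 1; split; first by apply/eqP; exact: oner_neq0.
  by exists id => //; apply/funext => v; rewrite rscale1.
- move=> _ _ [q [/eqP q0 [A gA ->]]] [p [/eqP p0 [B gB ->]]]; exists (p * q).
  split; first by apply/eqP; exact: quat_mul_neq0.
  exists (A \o B); first exact: GM.
  by apply/funext => v /=; have [_ _ ->] := GG A gA; rewrite rscaleA.
- move=> _ [q [/eqP q0 [A gA ->]]]; have [B [gB AB BA]] := GV A gA.
  exists (fun v => rscale (B v) (quat_inv q)); split.
  + exists (quat_inv q); split; first by apply/eqP; exact: quat_inv_neq0.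
    by exists B.
  + move=> v; have [_ _ ->] := GG B gB.
    by rewrite AB rscaleA quat_mulV // rscale1.
  + move=> v; have [_ _ ->] := GG A gA.
    by rewrite BA rscaleA quat_Vmul // rscale1.
Qed.

Lemma SOstar_sub (omega : Hn R n -> Hn R n -> quat R) : SOstar omega `<=` @GLH
  R n.
Proof. by move=> A []. Qed.

Lemma sub_Hstar_mul G : G `<=` Hstar_mul G.
Proof.
move=> A gA; exists 1; split; first by apply/eqP; exact: oner_neq0.
by exists A => //; apply/funext => v; rewrite rscale1.
Qed.

Lemma Hstar_mulS G G' : G `<=` G' -> Hstar_mul G `<=` Hstar_mul G'.
Proof. by move=> GG _ [q [q0 [A /GG gA ->]]]; exists q; split=> //; exists A.
  Qed.

Lemma Hstar_GLH_linear A : Hstar_mul (@GLH R n) A -> linear A /\ bijective A.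
Proof.
move=> gA; split; last first.
  have [_ _ /(_ _ gA)[B [_ AB BA]]] := Hstar_mul_group (@subset_refl _ _)
    GLH_group.
  by exists B.
case: gA => q [_ [B [lB _ _] ->]] c v w.
by rewrite lB rscaleDl rscaleZl.
Qed.

(** The real part of [conj q z q] is [|q|^2] times that of [z], so the scalar factor rescales the
    real part of the form by a positive number. *)
Lemma Hstar_SOstar_form (omega : Hn R n -> Hn R n -> quat R) A :
  quat_skew_hermitian (@rscale R n) omega -> Hstar_mul (SOstar omega) A ->
  exists2 c : R, 0 < c &
    forall v w, real_part omega (A v) (A w) = c * real_part omega v w.
Proof.
move=> oP [q [/eqP q0 [B [_ oB] ->]]]; exists (quat_norm2 q).
  by rewrite quat_norm2_gt0.
move=> v w; rewrite /real_part (qsh_rscalel oP) (qsh_rscaler oP) oB.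
case: q {q0} (omega v w) => [a b c d] [a' b' c' d'].
by rewrite /quat_norm2 !quatE /=; ring.
Qed.

(** The imaginary components of [z] are minus the real parts of [z i], [z j] and [z k], and right
    linearity moves these units into the second argument. *)
Lemma qsh_real_part (omega : Hn R n -> Hn R n -> quat R) v w :
  quat_skew_hermitian (@rscale R n) omega ->
  omega v w = Quat (real_part omega v w)
    (- real_part omega v (rscale w (Quat 0 1 0 0)))
    (- real_part omega v (rscale w (Quat 0 0 1 0)))
    (- real_part omega v (rscale w (Quat 0 0 0 1))).
Proof.
move=> oP; rewrite /real_part !(qsh_rscaler oP).
by case: (omega v w) => a b c d; rewrite !quatE /=; congr Quat; ring.
Qed.

Lemma Hstar_SOstar_of_form (omega : Hn R n -> Hn R n -> quat R) A (c : R) :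
  quat_skew_hermitian (@rscale R n) omega -> Hstar_mul (@GLH R n) A -> 0 < c ->
  (forall v w, c * real_part omega (A v) (A w) = real_part omega v w) ->
  Hstar_mul (SOstar omega) A.
Proof.
move=> oP [q [/eqP q0 [B gB ->]]] c0 AE.
have N0 : 0 < c * quat_norm2 q by rewrite mulr_gt0 // quat_norm2_gt0.
(* A real factor is moved from [q] to [B]: since [c |q|^2] times the real part of
   [omega (B v) (B w)] is that of [omega v w], the map [d B] preserves the real part. The square
   root exists because [c > 0]. *)
pose d := Num.sqrt (c * quat_norm2 q).
have d0 : 0 < d by rewrite sqrtr_gt0.
have dd : d * d = c * quat_norm2 q by rewrite -expr2 sqr_sqrtr // ltW.
exists (d^-1 *: q); split.
  apply/eqP; apply: contra_neq q0 => dq.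
  by rewrite -[q]scale1r -(mulfV (lt0r_neq0 d0)) -scalerA dq scaler0.
have [lB [C BC CB] hB] := gB.
exists (fun v => d *: B v); last first.
  apply/funext => v.
  by rewrite rscaleZr rscaleZl scalerA mulVf ?scale1r // gt_eqF.
have re v w : real_part omega (d *: B v) (d *: B w) = real_part omega v w.
  rewrite -[RHS]AE /real_part /= (qsh_rscalel oP) (qsh_rscaler oP).
  have -> : omega (d *: B v) (d *: B w) = (d * d) *: omega (B v) (B w).
    rewrite -[d *: B v]addr0 -[d *: B w]addr0 (qshPl oP) (qsh0l oP).
    by rewrite (qshPr oP) (qsh0r oP) !addr0 scalerA.
  rewrite dd; case: q {q0 N0 d d0 dd AE} (omega (B v) (B w)) => [a b e f] [? ?
    ? ?].
  by rewrite /quat_norm2 !quatE /=; ring.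
split; first split.
- by move=> k v w; rewrite lB scalerDr !scalerA [d * k]mulrC.
- exists (fun v => C (d^-1 *: v)) => v.
    by rewrite scalerA mulVf ?scale1r // gt_eqF.
  by rewrite CB scalerA mulfV ?scale1r // gt_eqF.
- by move=> v p; rewrite hB rscaleZl.
(* An H-linear map preserving the real part preserves the whole form. *)
move=> v w; rewrite [LHS](qsh_real_part _ _ oP) [RHS](qsh_real_part _ _ oP).
by rewrite !rscaleZl -!hB !re.
Qed.

Lemma real_part_nondeg (omega : Hn R n -> Hn R n -> quat R) :
  quat_skew_hermitian (@rscale R n) omega -> nondegenerate_form omega ->
  nondegenerate_form (real_part omega).
Proof.
move=> oP nd v v0; apply: nd => w.
by rewrite (qsh_real_part _ _ oP) !v0 oppr0.
Qed.

End StructureGroups.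

(** * Frames *)

Section Frames.
Variables (R : realType) (n : nat) (M : smoothManifold R (4 * n)).
Implicit Types (U : set M) (x y : M).
Local Notation V := (Hn R n).

(** The same choice of preimage as in [frame_rscale], so the two agree by unfolding; for a frame a
    preimage always exists and the default 0 is never taken. *)
Definition frame_inv x (u : V -> tangent x) (t : tangent x) : V :=
  xget 0 [set v | u v = t].

Section Frame.
Variables (x : M) (u : V -> tangent x).
Hypothesis uP : is_frame u.

Lemma frame_inj : injective u.
Proof. by case: uP => _ /bij_inj. Qed.

Lemma frame_invK t : u (frame_inv u t) = t.
Proof.
case: uP => _ [v uv vu]; rewrite /frame_inv.
by case: xgetP => [w -> //|/(_ (v t))]; rewrite /= vu.
Qed.

Lemma frameK v : frame_inv u (u v) = v.
Proof. by apply: frame_inj; rewrite frame_invK. Qed.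

Lemma frame_inv_linear : linear (frame_inv u).
Proof.
case: uP => lu _ c t t'; apply: frame_inj.
by rewrite frame_invK lu !frame_invK.
Qed.

Lemma frame_rscaleE v q : frame_rscale u (u v) q = u (rscale v q).
Proof. by rewrite /frame_rscale -/(frame_inv u (u v)) frameK. Qed.

Lemma is_frame_comp (A : V -> V) : linear A -> bijective A -> is_frame (u \o A).
Proof.
case: uP => lu bu lA bA; split; last exact: bij_comp.
by move=> c v w /=; rewrite lA; exact: lu.
Qed.

Lemma frame_sum v : u v = \sum_k rv v 0 k *: u (rbasis R k).
Proof.
case: uP => lu _; pose uM := GRing.isLinear.Build R V (tangent x) _ u lu.
pose uL : {linear V -> tangent x} := HB.pack u uM.
rewrite {1}[v]rbasis_sum -[u in LHS]/(uL : V -> tangent x) linear_sum.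
by apply: eq_bigr => k _; rewrite linearZ.
Qed.

End Frame.

Lemma smooth_frame_vector U (s : forall y, V -> tangent y) (w : M -> V) :
  open U -> (forall y, U y -> is_frame (s y)) ->
  (forall v, smooth_vector_field U (fun y => s y v)) -> smooth_hvec U w ->
  smooth_vector_field U (fun y => s y (w y)).
Proof.
move=> oU fs ss sw.
suff : smooth_vector_field U (fun y => \sum_k rv (w y) 0 k *: s y (rbasis R k)).
  by apply: eq_smooth_vector_field => // y /fs /frame_sum ->.
apply: smooth_vector_field_sum => // k.
by apply: smooth_vector_fieldZ => //; exact: smooth_rv.
Qed.

Lemma smooth_frame_coord U (s : forall y, V -> tangent y)
    (X : forall y : M, tangent y) k :
  open U -> (forall y, U y -> is_frame (s y)) ->
  (forall v, smooth_vector_field U (fun y => s y v)) ->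
  smooth_vector_field U X ->
  smooth_function U (fun y => rv (frame_inv (s y) (X y)) 0 k).
Proof.
move=> oU fs ss sX i.
have oW : open (chart_image U i) by exact: open_chart_image.
(* [S z] is the matrix of the frame in chart [i]: a vector with frame coordinates [c] has chart
   coordinates [c S], so [c] is recovered with [invmx (S z)]. *)
pose S z : 'M[R]_(4 * n) :=
  \matrix_(a, b) s (chart_param i z) (rbasis R a) i 0 b.
have SE z v : chart_image U i z -> s (chart_param i z) v i = rv v *m S z.
  move=> /chart_imageP[_ /fs /frame_sum -> _].
  rewrite mulmx_sum_row; elim/big_rec2: _ => // a t u _ <-.
  by rewrite tcoordD tcoordZ; congr (_ *: _ + _); apply/rowP => b; rewrite !mxE.
(* A row in the kernel gives a vector whose image under the frame has zero coordinates in one chart,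
   so it is 0 by injectivity of the frame. *)
have Su z : chart_image U i z -> S z \in unitmx.
  move=> Wz; have [zi zU _] := chart_imageP Wz.
  rewrite -row_free_unit -kermx_eq0; apply/rowV0P => u /sub_kermxP uS.
  have : s (chart_param i z) (vr u) = 0.
    by apply: (tangent_inj zi); rewrite SE // vrK.
  have s0 : s (chart_param i z) 0 = 0.
    by rewrite (frame_sum (fs _ zU)) big1 // => l _; rewrite linear0 mxE
      scale0r.
  rewrite -s0 => /(frame_inj (fs _ zU)) u0.
  by rewrite -[u]vrK u0 linear0.
have coord_smooth (Y : forall y : M, tangent y) b : smooth_vector_field U Y ->
    smooth_on (chart_image U i) ((fun z => Y (chart_param i z) i 0 b) : _ ->
      R^o).
  move=> sY h; pose L (r : 'rV[R]_(4 * n)) : R^o := r 0 b.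
  have lL : linear L by move=> c r r'; rewrite /L !mxE.
  pose LM := GRing.isLinear.Build _ _ _ _ L lL.
  pose LL : {linear 'rV[R]_(4 * n) -> R^o} := HB.pack L LM.
  apply: (@differentiable_upto_linear _ _ _ _ LL h _
    (fun z => Y (chart_param i z) i)) => //; last exact: sY.
  exact: coord_continuous.
have sS a b : smooth_on (chart_image U i) ((fun z => S z a b) : _ -> R^o).
  by under eq_fun do rewrite mxE; exact: coord_smooth (ss _).
have sfin : smooth_on (chart_image U i) ((fun z =>
    \sum_b X (chart_param i z) i 0 b * invmx (S z) b k) : _ -> R^o).
  apply: smooth_on_sum => // b; apply: smooth_onM => //; first exact:
    coord_smooth.
  exact: smooth_on_invmx.
move=> h; apply: eq_differentiable_upto (sfin h) => // z Wz /=.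
have [_ zU _] := chart_imageP Wz.
rewrite -{1}(frame_invK (fs _ zU) (X (chart_param i z))).
under eq_bigr do rewrite SE //.
set c := rv _.
by rewrite -[in RHS](mulmxK (Su z Wz) c) [RHS]mxE.
Qed.

Lemma smooth_real_part U (omega : V -> V -> quat R) (v w : M -> V) :
  quat_skew_hermitian (@rscale R n) omega -> open U ->
  (forall k, smooth_function U (fun y => rv (v y) 0 k)) ->
  (forall k, smooth_function U (fun y => rv (w y) 0 k)) ->
  smooth_function U (fun y => real_part omega (v y) (w y)).
Proof.
move=> oP oU sv sw.
have reZl c v' w' : real_part omega (c *: v') w' = c * real_part omega v' w'.
  by rewrite /real_part -[c *: v']addr0 (qshPl oP) (qsh0l oP) addr0.
have reZr c v' w' : real_part omega v' (c *: w') = c * real_part omega v' w'.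
  by rewrite /real_part -[c *: w']addr0 (qshPr oP) (qsh0r oP) addr0.
have re_sum (I : Type) (r : seq I) (F : I -> quat R) :
    qre (\sum_(j <- r) F j) = \sum_(j <- r) qre (F j).
  by elim: r => [|j r IH]; rewrite ?big_nil // !big_cons -IH.
suff : smooth_function U (fun y => \sum_k \sum_l
    rv (v y) 0 k * (rv (w y) 0 l * real_part omega (rbasis R k) (rbasis R l))).
  apply: eq_smooth_function => // y _; apply: esym.
  rewrite {1}[v y]rbasis_sum /real_part (qsh_suml oP) re_sum.
  apply: eq_bigr => k _; rewrite {1}[w y]rbasis_sum (qsh_sumr oP) re_sum.
  by apply: eq_bigr => l _; rewrite -/(real_part _ _ _) reZl reZr.
apply: smooth_function_sum => // k; apply: smooth_function_sum => // l.
do 2!apply: smooth_functionM => //; exact: smooth_function_cst.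
Qed.

End Frames.

(** * Reductions as orbits of local frames, and frames adapted to a section of the line *)

Section Reductions.
Variables (R : realType) (n : nat) (M : smoothManifold R (4 * n)).
Implicit Types (U : set M) (x y : M).
Local Notation V := (Hn R n).

Lemma translate_frames (G : set (V -> V)) x (u : V -> tangent x) A :
  transformation_group G -> G A ->
  [set u \o B | B in G] = [set (u \o A) \o B | B in G].
Proof.
move=> [G1 GM GV] GA; have [A' [GA' AA' A'A]] := GV A GA.
apply/seteqP; split=> _ [B GB <-].
  exists (A' \o B); first exact: GM.
  by apply/funext => v /=; rewrite A'A.
by exists (A \o B) => //; exact: GM.
Qed.

(** The criterion by which the reductions below are produced: it suffices that [P] is locally the
    [G]-orbit of a smooth frame. *)
Lemma reduction_of_section (G : set (V -> V)) U
    (P : forall x, set (V -> tangent x)) :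
  G `<=` Hstar_mul (@GLH R n) -> transformation_group G ->
  (forall x, U x -> exists U' (s : forall y, V -> tangent y),
    [/\ open_nbhs x U', U' `<=` U,
        forall v, smooth_vector_field U' (fun y => s y v)
      & forall y, U' y -> is_frame (s y) /\ P y = [set s y \o A | A in G]]) ->
  reduction G U P.
Proof.
move=> GG gG loc; have [G1 _ _] := gG.
have pt x : U x -> exists2 u : V -> tangent x, is_frame u & P x = [set u \o A |
  A in G].
  by move=> /loc[U' [s [[_ U'x] _ _ /(_ x U'x)[fs PE]]]]; exists (s x).
split.
- move=> x /pt[u fu ->] _ [A GA <-].
  by have [lA bA] := Hstar_GLH_linear (GG _ GA); exact: is_frame_comp.
- move=> x u' /pt[u fu ->] [A GA <-]; exact: translate_frames.
move=> x /loc[U' [s [U'x UU ss fs]]]; exists U', s; split=> // y /fs[_ ->].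
by exists id.
Qed.

Lemma local_section (G : set (V -> V)) U (P : forall x, set (V -> tangent x)) x
  :
  reduction G U P -> U x -> exists U' (s : forall y, V -> tangent y),
    [/\ open_nbhs x U', U' `<=` U,
        forall v, smooth_vector_field U' (fun y => s y v)
      & forall y, U' y -> [/\ P y (s y), is_frame (s y) & P y = [set s y \o A |
        A in G]]].
Proof.
move=> [fP PG loc] Ux; have [U' [s [U'x UU ss Ps]]] := loc x Ux.
exists U', s; split=> // y U'y; have Uy := UU _ U'y; split; first exact: Ps.
  by apply: fP => //; exact: Ps.
by apply: PG => //; exact: Ps.
Qed.

(** The extension of an orbit is the orbit of the larger group, because [G G' = G'] when [G] is
    contained in [G']. *)
Lemma extension_translates (G G' : set (V -> V)) (P : forall x, set (V ->
  tangent x))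
    x (u : V -> tangent x) : transformation_group G -> transformation_group G'
      ->
  G `<=` G' -> P x = [set u \o A | A in G] ->
  extension G' P x = [set u \o A | A in G'].
Proof.
move=> [G1 _ _] [_ GM _] GG PE; apply/seteqP; split.
  move=> _ [u' + [B GB <-]]; rewrite PE => -[A GA <-].
  by exists (A \o B) => //; apply: GM => //; exact: GG.
by move=> _ [B GB <-]; exists u; [rewrite PE; exists id|exists B].
Qed.

Lemma qsh_transport x (u : V -> tangent x) (omega : V -> V -> quat R) :
  is_frame u -> quat_skew_hermitian (@rscale R n) omega ->
  quat_skew_hermitian (frame_rscale u)
    (fun t t' => omega (frame_inv u t) (frame_inv u t')).
Proof.
move=> uP oP; have lv := frame_inv_linear uP; split.
- split=> [t'|t] c t1 t2 /=; rewrite lv; first by rewrite (qshPl oP).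
  by rewrite (qshPr oP).
- by move=> t t' q; rewrite /frame_rscale (frameK uP) (qsh_rscalel oP).
- by move=> t t' q; rewrite /frame_rscale (frameK uP) (qsh_rscaler oP).
- by move=> t t'; exact: qsh_skew.
Qed.

Lemma qsh_pullback x (u : V -> tangent x) (omega : tangent x -> tangent x ->
  quat R) :
  is_frame u -> quat_skew_hermitian (frame_rscale u) omega ->
  quat_skew_hermitian (@rscale R n) (fun v w => omega (u v) (u w)).
Proof.
move=> uP [[ol or'] oql oqr os]; have [lu _] := uP; split.
- split=> [w|v] c v1 v2 /=; rewrite lu; first exact: ol.
  exact: or'.
- by move=> v w q; rewrite -(frame_rscaleE uP) oql.
- by move=> v w q; rewrite -(frame_rscaleE uP) oqr.
- by move=> v w; exact: os.
Qed.

Lemma qsh_linear_pullback (omega : V -> V -> quat R) (B : V -> V) (c : R) :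
  GLH B -> quat_skew_hermitian (@rscale R n) omega ->
  quat_skew_hermitian (@rscale R n) (fun v w => c *: omega (B v) (B w)).
Proof.
move=> [lB _ hB] oP; split.
- split=> [w|v] d v1 v2 /=; rewrite lB; rewrite ?(qshPl oP) ?(qshPr oP);
  by rewrite scalerDr !scalerA [c * d]mulrC.
- by move=> v w q; rewrite hB (qsh_rscalel oP) quat_scalerAr.
- by move=> v w q; rewrite hB (qsh_rscaler oP) quat_scalerAl.
- by move=> v w; rewrite (qsh_skew oP (B v)) scalerN quat_conjZ.
Qed.

Section Model.
Variable omega : V -> V -> quat R.
Hypothesis oP : quat_skew_hermitian (@rscale R n) omega.
Local Notation G0 := (Hstar_mul (SOstar omega)).
Local Notation G1 := (Hstar_mul (@GLH R n)).

Lemma Hstar_SOstar_group : transformation_group G0.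
Proof. apply: Hstar_mul_group; [exact: SOstar_sub|exact: SOstar_group]. Qed.

Lemma Hstar_GLH_group : transformation_group G1.
Proof. by apply: Hstar_mul_group => //; exact: GLH_group. Qed.

Lemma Hstar_SOstar_sub : G0 `<=` G1.
Proof. by apply: Hstar_mulS; exact: SOstar_sub. Qed.

Section Lines.
Variables (x : M) (u : V -> tangent x) (P : forall x, set (V -> tangent x))
  (sigma : tangent x -> tangent x -> R).
Hypotheses (uP : is_frame u) (PE : @P x = [set u \o A | A in G0])
  (sE : forall v w, sigma (u v) (u w) = real_part omega v w).

(** Another frame of [P] is [u \o A] with [A] scaling the real part by a positive factor; [d] is its
    inverse. Its positivity makes the ray, and not only the line, independent of the frame. *)
Lemma induced_multiple u' beta (c : R) : @P x u' ->
  (forall v w, beta (u' v) (u' w) = c * real_part omega v w) ->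
  exists2 d : R, 0 < d & beta = (fun t t' => c * d * sigma t t').
Proof.
rewrite PE => -[A GA <-] bE; have [d d0 dE] := Hstar_SOstar_form oP GA.
have [_ _ /(_ A GA)[B [_ AB BA]]] := Hstar_SOstar_group.
exists d^-1; first by rewrite invr_gt0.
apply/funext => t; apply/funext => t'.
rewrite -{1 2}(frame_invK uP t) -{1 2}(frame_invK uP t') sE.
rewrite -[in LHS](BA (frame_inv u t)) -[in LHS](BA (frame_inv u t')) bE.
rewrite -[in RHS](BA (frame_inv u t)) -[in RHS](BA (frame_inv u t')) dE.
by rewrite -mulrA mulKf // gt_eqF.
Qed.

Lemma induced_lineE : induced_line (real_part omega) P x =
  [set beta | exists c : R, beta = (fun t t' => c * sigma t t')].
Proof.
apply/seteqP; split=> [beta [u' Pu' [c bE]]|_ [c ->]].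
  by have [d _ ->] := induced_multiple Pu' bE; exists (c * d).
exists u; first by rewrite PE; exists id => //; case: Hstar_SOstar_group.
by exists c => v w; rewrite sE.
Qed.

Lemma induced_rayE : induced_ray (real_part omega) P x =
  [set beta | exists2 c : R, 0 < c & beta = (fun t t' => c * sigma t t')].
Proof.
apply/seteqP; split=> [beta [u' Pu' [c c0 bE]]|_ [c c0 ->]].
  by have [d d0 ->] := induced_multiple Pu' bE; exists (c * d); rewrite
    ?mulr_gt0.
exists u; first by rewrite PE; exists id => //; case: Hstar_SOstar_group.
by exists c => // v w; rewrite sE.
Qed.

End Lines.

Hypothesis ond : nondegenerate_form omega.

Lemma adapted_section (Q : forall x, set (V -> tangent x)) x U
    (sigma : forall y, tangent y -> tangent y -> R) :
  almost_quaternionic Q -> open_nbhs x U -> smooth_form U sigma ->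
  (forall y, U y -> nondegenerate_form (sigma y)) ->
  (forall y u, U y -> Q y u -> exists2 om, quat_skew_hermitian (frame_rscale u)
    om
     & sigma y = real_part om) ->
  exists U' (s : forall y, V -> tangent y), [/\ open_nbhs x U', U' `<=` U,
     forall v, smooth_vector_field U' (fun y => s y v)
   & forall y, U' y -> [/\ is_frame (s y), Q y = [set s y \o A | A in G1]
     & forall v w, sigma y (s y v) (s y w) = real_part omega v w]].
Proof.
move=> QP [oU Ux] ss snd scomp.
have [U1 [s1 [[oU1 U1x] _ s1s s1P]]] := local_section QP (I : setT x).
pose U2 := U `&` U1.
have oU2 : open U2 by exact: openI.
have U2x : open_nbhs x U2 by [].
(* Compatibility yields a quaternionic form at each point with no smoothness in the point.
   Rebuilding it from its real part exhibits its components as values of [sigma] on smooth vector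
   fields. *)
pose Om y v w := Quat (sigma y (s1 y v) (s1 y w))
  (- sigma y (s1 y v) (s1 y (rscale w (Quat 0 1 0 0))))
  (- sigma y (s1 y v) (s1 y (rscale w (Quat 0 0 1 0))))
  (- sigma y (s1 y v) (s1 y (rscale w (Quat 0 0 0 1)))).
have OmE y : U2 y -> quat_skew_hermitian (@rscale R n) (Om y).
  move=> [Uy /s1P[Qs fs _]]; have [om omP omE] := scomp y _ Uy Qs.
  have := qsh_pullback fs omP; congr quat_skew_hermitian.
  apply/funext => v; apply/funext => w.
  by rewrite (qsh_real_part _ _ (qsh_pullback fs omP)) /Om omE.
have Om_nd y : U2 y -> nondegenerate_form (Om y).
  move=> [Uy /s1P[_ fs _]] v v0.
  apply: (frame_inj fs); have s0 : s1 y 0 = 0.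
    by rewrite (frame_sum fs) big1 // => l _; rewrite linear0 mxE scale0r.
  rewrite s0; apply: (snd y Uy) => t; rewrite -(frame_invK fs t).
  by have [] := v0 (frame_inv (s1 y) t).
have s1s2 v : smooth_vector_field U2 (fun y => s1 y v).
  by apply: sub_smooth_vector_field (s1s v) => y [].
have Om_s v w : smooth_quat U2 (fun y => Om y v w).
  have U2U : U2 `<=` U by move=> y [].
  by split; rewrite /=; try apply: smooth_functionN => //; exact: ss.
have [U3 [f [[oU3 U3x] U32 fs fP]]] :=
  smooth_orthonormal U2x OmE Om_nd (fun a b => Om_s _ _).
(* The constant family [omega] is treated by the same lemma; only the basis [g] at the point [x] is
   kept. *)
have [U4 [g [[_ U4x] _ _ gP]]] :=
  smooth_orthonormal (Om := fun=> omega) (conj openT (I : setT x)) (fun _ _ =>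
    oP)
    (fun _ _ => ond) (fun a b => smooth_quat_cst _ _).
(* [B y] takes the fixed basis of the model to the basis [f] at [y], so it carries [omega] to
   [Om y]. *)
pose B y := frame_change omega (f^~ y) (g^~ x).
exists U3, (fun y => s1 y \o B y); split=> //; first by move=> y /U32[].
  move=> v; apply: smooth_frame_vector => //.
  - by move=> y /U32[_ /s1P[]].
  - by move=> w; apply: sub_smooth_vector_field (s1s2 w).
  - by apply: smooth_hcomb => // a; exact: smooth_quat_cst.
move=> y U3y; have U2y := U32 _ U3y; have [Uy U1y] := U2y.
have [Qs sfr QE] := s1P _ U1y.
have BG : GLH (B y).
  split; [exact: frame_change_linear| |by move=> v q; exact:
    frame_change_rscale].
  exists (frame_change (Om y) (g^~ x) (f^~ y)).
    by apply: frame_changeK => //; [exact: OmE|exact: fP|exact: gP].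
  by apply: frame_changeK => //; [exact: OmE|exact: gP|exact: fP].
split.
- by apply: is_frame_comp => //; case: BG.
(* [B y] lies in [GL(n, H)], so the corrected frame generates the same quaternionic structure. *)
- by rewrite QE; apply: translate_frames Hstar_GLH_group _; exact:
  sub_Hstar_mul.
move=> v w; rewrite /real_part.
by rewrite -(frame_change_form (OmE _ U2y) oP (fP _ U3y) (gP _ U4x)).
Qed.

End Model.
End Reductions.

(** * The correspondence *)

Section Main.
Variables (R : realType) (n : nat) (M : smoothManifold R (4 * n)).
Implicit Types (U : set M) (x y : M).
Local Notation V := (Hn R n).
Variable omega : V -> V -> quat R.
Hypotheses (n_gt0 : (0 < n)%N) (oP : quat_skew_hermitian (@rscale R n) omega)
  (ond : nondegenerate_form omega).
Local Notation G0 := (Hstar_mul (SOstar omega)).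
Local Notation G1 := (Hstar_mul (@GLH R n)).
Local Notation frames := (forall x : M, set (V -> tangent x)).
Local Notation lines := (forall x : M, set (tangent x -> tangent x -> R)).

Definition frame_form x (u : V -> tangent x) (t t' : tangent x) : R :=
  real_part omega (frame_inv u t) (frame_inv u t').

Lemma frame_formE x (u : V -> tangent x) v w : is_frame u ->
  frame_form u (u v) (u w) = real_part omega v w.
Proof. by move=> uP; rewrite /frame_form !(frameK uP). Qed.

Lemma frame_form_nondeg x (u : V -> tangent x) : is_frame u ->
  nondegenerate_form (frame_form u).
Proof.
move=> uP t t0.
have vt0 : frame_inv u t = 0.
  apply: (real_part_nondeg oP ond) => v.
  by have := t0 (u v); rewrite /frame_form (frameK uP).
have [lu _] := uP; rewrite -(frame_invK uP t) vt0.
by rewrite (frame_sum uP) big1 // => l _; rewrite linear0 mxE scale0r.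
Qed.

Lemma frame_form_skew x (u : V -> tangent x) : is_frame u ->
  skew_bilinear (frame_form u).
Proof.
move=> uP; have lv := frame_inv_linear uP; split.
  split=> [t'|t] c t1 t2 /=; rewrite /frame_form lv /real_part.
    by rewrite (qshPl oP).
  by rewrite (qshPr oP).
by move=> t t'; rewrite /frame_form /real_part (qsh_skew oP).
Qed.

Lemma frame_form_neq0 x (u : V -> tangent x) : is_frame u -> frame_form u <> 0.
Proof.
move=> uP u0; have nd := frame_form_nondeg uP.
(* If the zero form were nondegenerate, every vector would vanish; [n > 0] provides a basis vector
   for the contradiction. *)
have : rbasis R (mxvec_index (ord0 : 'I_4) (Ordinal n_gt0)) = 0.
  apply: (frame_inj uP); rewrite (nd (u _)) => [|t]; last by rewrite u0.
  by rewrite (nd (u 0)) // => t; rewrite u0.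
move/(congr1 (@rv R n)); rewrite /rbasis vrK linear0 => /matrixP.
move/(_ 0 (mxvec_index (ord0 : 'I_4) (Ordinal n_gt0))).
by rewrite !mxE !eqxx => /eqP; rewrite oner_eq0.
Qed.

Lemma smooth_frame_form U (s : forall y, V -> tangent y) :
  (forall y, U y -> is_frame (s y)) ->
  (forall v, smooth_vector_field U (fun y => s y v)) ->
  smooth_form U (fun y => frame_form (s y)).
Proof.
move=> fs ss U' X Y oU' UU sX sY.
have fs' y : U' y -> is_frame (s y) by move/UU; exact: fs.
have ss' v : smooth_vector_field U' (fun y => s y v).
  exact: sub_smooth_vector_field (ss v).
by apply: smooth_real_part => // k; exact: smooth_frame_coord.
Qed.

Lemma PACS_underlying (P : frames) : PACS_on omega setT P ->
  [/\ almost_quaternionic (underlying_quaternionic P),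
      almost_conformally_symplectic (underlying_acs omega P),
      real_part_compatible (underlying_quaternionic P) (underlying_acs omega P)
    & line_orientation (underlying_acs omega P) (underlying_orientation omega
      P)].
Proof.
move=> PP; have loc x := local_section PP (I : setT x).
have gG0 := Hstar_SOstar_group omega; have gG1 := @Hstar_GLH_group R n.
have QE x (u : V -> tangent x) : P x = [set u \o A | A in G0] ->
    underlying_quaternionic P x = [set u \o A | A in G1].
  by apply: extension_translates => //; exact: Hstar_SOstar_sub.
have lE x (u : V -> tangent x) : is_frame u -> P x = [set u \o A | A in G0] ->
    underlying_acs omega P x =
    [set beta | exists c : R, beta = (fun t t' => c * frame_form u t t')].
  by move=> uP PE; apply: (induced_lineE oP uP PE) => v w; exact: frame_formE.
have rE x (u : V -> tangent x) : is_frame u -> P x = [set u \o A | A in G0] ->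
    underlying_orientation omega P x =
    [set beta | exists2 c : R, 0 < c & beta = (fun t t' => c * frame_form u t
      t')].
  by move=> uP PE; apply: (induced_rayE oP uP PE) => v w; exact: frame_formE.
split.
- apply: reduction_of_section => // x _.
  have [U [s [Ux UU ss sP]]] := loc x; exists U, s; split=> // y /sP[_ fs PE].
  by split=> //; exact: QE.
- split=> [x|x beta].
    have [U [s [Ux UU ss sP]]] := loc x; exists U, (fun y => frame_form (s y)).
    split=> //; first by apply: smooth_frame_form => // y /sP[].
    move=> y /sP[_ fs PE]; split; [exact: frame_form_skew|exact:
      frame_form_neq0|].
    exact: lE.
  have [U [s [[_ Ux] _ _ sP]]] := loc x; have [_ fs PE] := sP x Ux.
  rewrite (lE _ _ fs PE) => -[c ->] b0 t t0.
  apply: (frame_form_nondeg fs) => t'.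
  have /eqP := t0 t'; rewrite mulf_eq0 => /orP[/eqP c0|/eqP//].
  by case: b0; apply/funext => v; apply/funext => w; rewrite c0 mul0r.
- move=> x beta lb b0 u.
  have [U [s [[_ Ux] _ _ sP]]] := loc x; have [_ fs PE] := sP x Ux.
  move: lb; rewrite (lE _ _ fs PE) (QE _ _ PE) => -[c bE] [A GA uE].
  have [lA bA] := Hstar_GLH_linear GA.
  have fu : is_frame u by rewrite -uE; exact: is_frame_comp.
  have [q [_ [B gB AE]]] := GA.
  (* Here [u = s \o A] with [A v = B v q]. Passing from [s] to [u] replaces the real part of [omega]
     by [|q|^2] times its pullback along [B], which is again skew-Hermitian for the scalars given by
     [u]. *)
  exists (fun t t' => (c * quat_norm2 q) *:
      omega (B (frame_inv u t)) (B (frame_inv u t'))).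
    exact: qsh_transport fu (qsh_linear_pullback (c * quat_norm2 q) gB oP).
  rewrite bE; apply/funext => t; apply/funext => t'.
  rewrite -{1}(frame_invK fu t) -{1}(frame_invK fu t') -{1 3}uE /= frame_formE
    //.
  rewrite AE /real_part (qsh_rscalel oP) (qsh_rscaler oP).
  case: q {AE} (omega _ _) => [a b d e] [? ? ? ?].
  by rewrite /quat_norm2 !quatE /=; ring.
move=> x; have [U [s [Ux UU ss sP]]] := loc x; exists U, (fun y => frame_form
  (s y)).
split=> //; first by apply: smooth_frame_form => // y /sP[].
move=> y /sP[_ fs PE]; split; last exact: rE.
- rewrite (lE _ _ fs PE); exists 1; apply/funext => t; apply/funext => t'.
  by rewrite mul1r.
- exact: frame_form_neq0.
Qed.

(** * From the underlying structures back to PACS-structures *)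

Section Converse.
Variables (Q : frames) (l : lines).
Hypotheses (QP : almost_quaternionic Q) (lP : almost_conformally_symplectic l)
  (Ql : real_part_compatible Q l).

Lemma adapted_line_section x U (sigma : forall y, tangent y -> tangent y -> R) :
  open_nbhs x U -> smooth_form U sigma ->
  (forall y, U y -> @l y (sigma y) /\ sigma y <> 0) ->
  exists U' (s : forall y, V -> tangent y), [/\ open_nbhs x U', U' `<=` U,
     forall v, smooth_vector_field U' (fun y => s y v)
   & forall y, U' y -> [/\ is_frame (s y), @Q y = [set s y \o A | A in G1]
     & forall v w, sigma y (s y v) (s y w) = real_part omega v w]].
Proof.
move=> Ux ss sP; apply: adapted_section => //.
  by move=> y /sP[lyy n0]; case: lP => _ /(_ y _ lyy n0).
by move=> y u /sP[lyy n0] Qu; exact: (Ql lyy n0 Qu).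
Qed.

Lemma PACS_local x : exists U (P : frames), [/\ open_nbhs x U, PACS_on omega U P
  & forall y, U y -> underlying_quaternionic P y = @Q y /\ underlying_acs omega
    P y = @l y].
Proof.
have [U [sigma [Ux ss sP]]] := lP.1 x.
have sl y : U y -> @l y (sigma y) /\ sigma y <> 0.
  move=> /sP[_ n0 ->]; split=> //; exists 1.
  by apply/funext => v; apply/funext => w; rewrite mul1r.
have [U' [s [U'x UU s_smooth s_adapted]]] := adapted_line_section Ux ss sl.
(* The local structure is the [G0]-orbit of the adapted frame; the sign of [sigma] is arbitrary
   here. *)
exists U', (fun y => [set s y \o A | A in G0]); split=> //.
  apply: reduction_of_section; [exact: Hstar_SOstar_sub|exact:
    Hstar_SOstar_group|move=> y U'y].
  exists U', s; split=> //; first by case: U'x.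
  by move=> z /s_adapted[].
move=> y U'y; have [fs QE sE] := s_adapted y U'y; have [_ _ lE] := sP _ (UU _
  U'y).
split.
  rewrite QE; exact: (extension_translates (P := fun y => [set s y \o A | A in
    G0])
    (Hstar_SOstar_group omega) (@Hstar_GLH_group R n) (@Hstar_SOstar_sub R n
      omega) erefl).
by rewrite lE; exact: (induced_lineE oP fs _ sE).
Qed.

Section Oriented.
Variable o : lines.
Hypothesis lo : line_orientation l o.

(** A pointwise description free of local choices, so that nothing has to be glued: the quaternionic
    frames carrying the real part of [omega] to an element of the chosen ray. *)
Definition oriented_frames : frames := fun x => [set u | @Q x u /\
  exists2 beta, @o x beta & forall v w, beta (u v) (u w) = real_part omega v w].

Lemma oriented_framesP x : exists U (s : forall y, V -> tangent y)
    (sigma : forall y, tangent y -> tangent y -> R), [/\ open_nbhs x U,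
    forall v, smooth_vector_field U (fun y => s y v)
  & forall y, U y ->
    [/\ is_frame (s y) /\ @Q y = [set s y \o A | A in G1],
        @oriented_frames y = [set s y \o A | A in G0],
        forall v w, sigma y (s y v) (s y w) = real_part omega v w,
        @l y = [set beta | exists c : R, beta = (fun t t' => c * sigma y t t')]
      & @o y = [set beta | exists2 c : R, 0 < c & beta = (fun t t' => c * sigma
        y t t')]]].
Proof.
have [U [sigma [Ux ss sP]]] := lo x.
have sl y : U y -> @l y (sigma y) /\ sigma y <> 0 by move=> /sP[].
have [U' [s [U'x UU s_smooth s_adapted]]] := adapted_line_section Ux ss sl.
exists U', s, sigma; split=> // y U'y.
have [fs QE sE] := s_adapted y U'y; have [ly n0 oE] := sP _ (UU _ U'y).
split=> //.
(* Two quaternionic frames that carry the model form into the same ray differ by an [A] scaling it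
   positively, hence by an element of [G0]. *)
- apply/seteqP; split=> [u [Qu [beta]]|_ [A GA <-]].
    rewrite oE => -[c c0 ->] uE; move: Qu uE; rewrite QE => -[A GA <-] uE.
    exists A => //; apply: (Hstar_SOstar_of_form oP GA c0) => v w.
    by rewrite -sE uE.
  split; first by rewrite QE; exists A => //; exact: Hstar_SOstar_sub GA.
  have [c c0 cE] := Hstar_SOstar_form oP GA.
  (* The frame [s y \o A] pulls [sigma y] back to [c] times the model form, so the witness is
     divided by [c], which stays in the ray. *)
  exists (fun t t' => c^-1 * sigma y t t').
    by rewrite oE; exists c^-1; rewrite ?invr_gt0.
  by move=> v w /=; rewrite sE cE mulKf // gt_eqF.
(* The section [sigma] of the ray is a nonzero multiple of a generator [tau] of the line, so it
   spans the line too. *)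
- have [V' [tau [[_ V'y] _ tP]]] := lP.1 y; have [_ t0 lE] := tP _ V'y.
  move: ly n0; rewrite lE => -[c ->] n0.
  have c0 : c != 0.
    apply/eqP => c0; apply: n0; apply/funext => v; apply/funext => w.
    by rewrite c0 mul0r.
  apply/seteqP; split=> _ [d ->].
    exists (d / c); apply/funext => v; apply/funext => w.
    by rewrite mulrA divfK.
  by exists (d * c); apply/funext => v; apply/funext => w; rewrite mulrA.
Qed.

Lemma oriented_frames_PACS : [/\ PACS_on omega setT oriented_frames,
  underlying_quaternionic oriented_frames = Q,
  underlying_acs omega oriented_frames = l
  & underlying_orientation omega oriented_frames = o].
Proof.
split.
- apply: reduction_of_section; [exact: Hstar_SOstar_sub|exact:
  Hstar_SOstar_group|move=> x _].
  have [U [s [sigma [Ux s_smooth sP]]]] := oriented_framesP x.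
  by exists U, s; split=> // y /sP[[fs _] PE].
- apply: functional_extensionality_dep => x.
  have [U [s [sigma [[_ Ux] _ /(_ x Ux)[[fs ->] PE _ _ _]]]]] :=
    oriented_framesP x.
  exact: (extension_translates (Hstar_SOstar_group omega) (@Hstar_GLH_group R n)
    (@Hstar_SOstar_sub R n omega) PE).
- apply: functional_extensionality_dep => x.
  have [U [s [sigma [[_ Ux] _ /(_ x Ux)[[fs _] PE sE -> _]]]]] :=
    oriented_framesP x.
  exact: (induced_lineE oP fs PE sE).
- apply: functional_extensionality_dep => x.
  have [U [s [sigma [[_ Ux] _ /(_ x Ux)[[fs _] PE sE _ ->]]]]] :=
    oriented_framesP x.
  exact: (induced_rayE oP fs PE sE).
Qed.

(** Both structures are [G0]-orbits at each point, so one common frame is enough. Any frame of [P]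
    serves: it induces [Q], and its own form lies in the ray [o]. *)
Lemma oriented_frames_unique (P : frames) : PACS_on omega setT P ->
  underlying_quaternionic P = Q -> underlying_orientation omega P = o ->
  oriented_frames = P.
Proof.
move=> PP PQ Po; apply: functional_extensionality_dep => x.
have [U [s [[_ Ux] _ _ /(_ x Ux)[Ps fs ->]]]] := local_section PP (I : setT x).
have [[_ orb _] _ _ _] := oriented_frames_PACS.
apply: orb => //; split.
  by rewrite -PQ; exists (s x) => //; exists id => //; case: (@Hstar_GLH_group
    R n).
exists (frame_form (s x)); last by move=> v w; exact: frame_formE.
rewrite -Po; exists (s x) => //; exists 1 => // v w.
by rewrite frame_formE // mul1r.
Qed.

End Oriented.
End Converse.
End Main.

Theorem proposition3p6 (R : realType) (n : nat) (n_ge2 : (2 <= n)%N)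
    (M : smoothManifold R (4 * n))
    (omega : Hn R n -> Hn R n -> quat R)
    (omega_skew : quat_skew_hermitian (@rscale R n) omega)
    (omega_nondeg : nondegenerate_form omega) :
  (forall P : forall x : M, set (Hn R n -> tangent x),
     PACS_on omega setT P ->
     [/\ almost_quaternionic (underlying_quaternionic P),
         almost_conformally_symplectic (underlying_acs omega P),
         real_part_compatible (underlying_quaternionic P)
           (underlying_acs omega P)
       & line_orientation (underlying_acs omega P)
           (underlying_orientation omega P)]) /\
  (forall (Q : forall x : M, set (Hn R n -> tangent x))
          (l : forall x : M, set (tangent x -> tangent x -> R)),
     almost_quaternionic Q -> almost_conformally_symplectic l ->
     real_part_compatible Q l ->
     (forall x : M, exists (U : set M)
          (P : forall y : M, set (Hn R n -> tangent y)),
        [/\ open_nbhs x U, PACS_on omega U P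
          & forall y, U y -> underlying_quaternionic P y = Q y /\
                             underlying_acs omega P y = l y]) /\
     (forall o : forall x : M, set (tangent x -> tangent x -> R),
        line_orientation l o ->
        exists! P : forall x : M, set (Hn R n -> tangent x),
          [/\ PACS_on omega setT P, underlying_quaternionic P = Q,
              underlying_acs omega P = l
            & underlying_orientation omega P = o])).
Proof.
have n_gt0 : (0 < n)%N by exact: ltnW.
split; first by move=> P; exact: PACS_underlying.
move=> Q l QP lP Ql; split; first by move=> x; exact: PACS_local.
move=> o lo; exists (oriented_frames omega Q o); split.
  exact: (oriented_frames_PACS omega_skew omega_nondeg QP lP Ql lo).
move=> P [PP PQ _ Po].
exact: (oriented_frames_unique omega_skew omega_nondeg QP lP Ql lo).
Qed.
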